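(* The bicomplex Hermite polynomials $\{H_{m,n}(Z,Z^* ) : m,n=0,1,\dots\}$ form an orthogonal basis of the split-bicomplex Hilbert space $L^2_{split}(\mathbb{BC},e^{-ZZ^*})$. Moreover, for all integers $m,n\ge0$, $$\|H_{m,n}\|^2_{L^2_{split}(\mathbb{BC},e^{-ZZ^*})}=m!\,n!.$$
   Context: Bicomplex numbers: $\mathbb{BC}$ is the commutative real algebra generated by two commuting imaginary units $\mathbf{i},\mathbf{j}$ ($\mathbf{i}^2=\mathbf{j}^2=-1$), with $\mathbf{k}=\mathbf{i}\mathbf{j}$, $\mathbf{k}^2=1$. Put $\mathbf{e}_1=\frac{1+\mathbf{k}}{2}$, $\mathbf{e}_2=\frac{1-\mathbf{k}}{2}$ (idempotents with $\mathbf{e}_1\mathbf{e}_2=0$, $\mathbf{e}_1+\mathbf{e}_2=1$). Each $Z=z_1+\mathbf{j}z_2$ with $z_1,z_2\in\mathbb{C}=\mathbb{C}(\mathbf{i})$ is uniquely $Z=\lambda_1\mathbf{e}_1+\lambda_2\mathbf{e}_2$ with $\lambda_1=z_1-\mathbf{i}z_2$, $\lambda_2=z_1+\mathbf{i}z_2\in\mathbb{C}$. The $*$-conjugate is $Z^*=\overline{z_1}-\mathbf{j}\overline{z_2}=\overline{\lambda_1}\mathbf{e}_1+\overline{\lambda_2}\mathbf{e}_2$. The $Z^*$-bicomplex Hermite polynomials of the first kind are, for integers $m,n\ge0$, $$H_{m,n}(Z,Z^* )=\sum_{k=0}^{\min(m,n)}(-1)^k k!\binom{m}{k}\binom{n}{k}Z^{m-k}(Z^*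 )^{n-k}.$$ The space $L^2_{split}(\mathbb{BC},e^{-ZZ^*})$ is the $\mathbb{BC}$-module of split functions $f(\lambda_1\mathbf{e}_1+\lambda_2\mathbf{e}_2)=f_1(\lambda_1)\mathbf{e}_1+f_2(\lambda_2)\mathbf{e}_2$ with $f_1,f_2$ in $L^2(\mathbb{C},\mu)$, where $d\mu(\lambda)=\frac1\pi e^{-|\lambda|^2}dA(\lambda)$ is the normalized Gaussian measure ($dA$ Lebesgue measure). It carries the componentwise bicomplex-valued inner product $\langle f,g\rangle=\langle f_1,g_1\rangle_{L^2(\mathbb{C},\mu)}\mathbf{e}_1+\langle f_2,g_2\rangle_{L^2(\mathbb{C},\mu)}\mathbf{e}_2$, and $\|f\|^2=\langle f,f\rangle=\|f_1\|^2_{L^2(\mathbb{C},\mu)}\mathbf{e}_1+\|f_2\|^2_{L^2(\mathbb{C},\mu)}\mathbf{e}_2$ (a non-negative hyperbolic number; a real number $r$ is identified with $r\mathbf{e}_1+r\mathbf{e}_2$). ''Orthogonal basis'' means: distinct elements have inner product $0$, and every $f$ in the space has a unique expansion $f=\sum_{m,n}H_{m,n}(Z,Z^* )\gamma_{m,n}$ with $\gamma_{m,n}\in\mathbb{BC}$, convergent in $L^2(\mathbb{C},\mu)$ in each component. *)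

(* Defs.v *)
From HB Require Import structures.
From mathcomp Require Import all_boot all_order all_algebra finmap.
From mathcomp Require Import all_classical all_reals all_analysis.
From mathcomp Require Import showcase.summability.
From mathcomp.real_closed Require Import complex.
From mathcomp Require Import measurable_realfun ring.

Set Implicit Arguments.
Unset Strict Implicit.
Unset Printing Implicit Defensive.

Import Order.TTheory GRing.Theory Num.Theory.
Import numFieldNormedType.Exports.
Import Normc.

Local Open Scope classical_set_scope.
Local Open Scope ring_scope.
Local Open Scope complex_scope.

(* [Bicomplex z1 z2] is z1 + j z2, with z1, z2 in C(i) = R[i]. *)
Record bicomplex (R : Type) := Bicomplex { bc1 : R[i]; bc2 : R[i] }.

Section BicomplexRing.
Variable R : rcfType.
Local Notation BC := (bicomplex R).

Definition pair_of_bc (Z : BC) : R[i] * R[i] := (bc1 Z, bc2 Z).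
Definition bc_of_pair (p : R[i] * R[i]) : BC := Bicomplex p.1 p.2.
Lemma pair_of_bcK : cancel pair_of_bc bc_of_pair. Proof. by case. Qed.

HB.instance Definition _ := Choice.copy BC (can_type pair_of_bcK).

Definition bc0 : BC := Bicomplex 0 0.
Definition bc_one : BC := Bicomplex 1 0.
Definition bcadd (Z W : BC) : BC := Bicomplex (bc1 Z + bc1 W) (bc2 Z + bc2 W).
Definition bcopp (Z : BC) : BC := Bicomplex (- bc1 Z) (- bc2 Z).
Definition bcmul (Z W : BC) : BC :=
  Bicomplex (bc1 Z * bc1 W - bc2 Z * bc2 W) (bc1 Z * bc2 W + bc2 Z * bc1 W).

Lemma bcaddA : associative bcadd.
Proof. by move=> Z W V; rewrite /bcadd /= !addrA. Qed.
Lemma bcaddC : commutative bcadd.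
Proof. by move=> Z W; congr Bicomplex; rewrite addrC. Qed.
Lemma bcadd0 : left_id bc0 bcadd.
Proof. by case=> a b; rewrite /bcadd /= !add0r. Qed.
Lemma bcaddN : left_inverse bc0 bcopp bcadd.
Proof. by move=> Z; rewrite /bcadd /= !addNr. Qed.

HB.instance Definition _ :=
  GRing.isZmodule.Build BC bcaddA bcaddC bcadd0 bcaddN.

Lemma bcmulA : associative bcmul.
Proof. by move=> Z W V; congr Bicomplex => /=; ring. Qed.
Lemma bcmulC : commutative bcmul.
Proof. by move=> Z W; congr Bicomplex => /=; ring. Qed.
Lemma bcmul1 : left_id bc_one bcmul.
Proof. by case=> a b; congr Bicomplex => /=; ring. Qed.
Lemma bcmulDl : left_distributive bcmul +%R.
Proof. by move=> Z W V; congr Bicomplex => /=; ring. Qed.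
Lemma bc_one_neq0 : bc_one != 0.
Proof. by apply/eqP => -[/eqP]; rewrite oner_eq0. Qed.

HB.instance Definition _ := GRing.Zmodule_isComNzRing.Build BC
  bcmulA bcmulC bcmul1 bcmulDl bc_one_neq0.

Definition bc_of (z : R[i]) : BC := Bicomplex z 0.
Definition bci : BC := bc_of 'i%C.
Definition bcj : BC := Bicomplex 0 1.
Definition bck : BC := bci * bcj.
Definition bce1 : BC := bc_of 2^-1 * (1 + bck).
Definition bce2 : BC := bc_of 2^-1 * (1 - bck).

Definition lam1 (Z : BC) : R[i] := bc1 Z - 'i%C * bc2 Z.
Definition lam2 (Z : BC) : R[i] := bc1 Z + 'i%C * bc2 Z.

Definition bcsplit (l1 l2 : R[i]) : BC := bc_of l1 * bce1 + bc_of l2 * bce2.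

(* The conjugate Z^*. *)
Definition bcstar (Z : BC) : BC := Bicomplex (conjc (bc1 Z)) (- conjc (bc2 Z)).

Lemma sqri : ('i%C * 'i%C : R[i]) = -1.
Proof. by rewrite -expr2 sqr_i. Qed.

Lemma bci_sqr : bci * bci = -1.
Proof.
change (bcmul bci bci = Bicomplex (-1) (- 0)).
by congr Bicomplex; rewrite /= ?sqri; ring.
Qed.

Lemma bcj_sqr : bcj * bcj = -1.
Proof.
change (bcmul bcj bcj = Bicomplex (-1) (- 0)).
by congr Bicomplex => /=; ring.
Qed.

Lemma bcsplitE l1 l2 :
  bcsplit l1 l2 = Bicomplex ((l1 + l2) / 2) ('i%C * (l1 - l2) / 2).
Proof.
have bckE : bck = Bicomplex 0 'i%C.
  by change (bcmul bci bcj = Bicomplex 0 'i%C); congr Bicomplex => /=; ring.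
rewrite /bcsplit /bce1 /bce2 bckE.
change (bcadd
  (bcmul (bc_of l1) (bcmul (bc_of 2^-1) (bcadd bc_one (Bicomplex 0 'i%C))))
  (bcmul (bc_of l2) (bcmul (bc_of 2^-1) (bcadd bc_one (bcopp (Bicomplex 0 'i%C)))))
  = Bicomplex ((l1 + l2) / 2) ('i%C * (l1 - l2) / 2)).
by congr Bicomplex => /=; ring.
Qed.

Lemma bcsplitK Z : bcsplit (lam1 Z) (lam2 Z) = Z.
Proof.
case: Z => a b; rewrite bcsplitE /lam1 /lam2 /=; congr Bicomplex.
  by field.
rewrite (_ : 'i%C * _ / 2 = - ('i%C * 'i%C) * b); last by field.
by rewrite sqri; ring.
Qed.

Lemma lam1_split l1 l2 : lam1 (bcsplit l1 l2) = l1.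
Proof.
rewrite bcsplitE /lam1 /=.
rewrite (_ : _ - _ = (l1 + l2 - ('i%C * 'i%C) * (l1 - l2)) / 2); last by field.
by rewrite sqri; field.
Qed.

Lemma lam2_split l1 l2 : lam2 (bcsplit l1 l2) = l2.
Proof.
rewrite bcsplitE /lam2 /=.
rewrite (_ : _ + _ = (l1 + l2 + ('i%C * 'i%C) * (l1 - l2)) / 2); last by field.
by rewrite sqri; field.
Qed.

Lemma conjc2V : conjc (2^-1 : R[i]) = 2^-1.
Proof. by rewrite -[2]/(2%:R) -{1}(conjc_nat _ 2) -conjc_inv conjcK. Qed.

Lemma bcstar_split l1 l2 :
  bcstar (bcsplit l1 l2) = bcsplit (conjc l1) (conjc l2).
Proof.
have half (x : R[i]) : conjc (x / 2) = conjc x / 2.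
  by rewrite rmorphM; congr (_ * _); exact: conjc2V.
have ci : conjc 'i%C = - 'i%C :> R[i].
  by apply/eqP; rewrite eq_complex /= oppr0 !eqxx.
rewrite !bcsplitE /bcstar; cbn [bc1 bc2]; congr Bicomplex.
  by rewrite half rmorphD.
rewrite half (_ : conjc _ = - 'i%C * (conjc l1 - conjc l2)); first by ring.
by rewrite rmorphM rmorphB; congr (_ * _); exact: ci.
Qed.

Definition bchermite2 (m n : nat) (Z W : BC) : BC :=
  \sum_(k < (minn m n).+1)
    (-1) ^+ k * (k`! * 'C(m, k) * 'C(n, k))%:R * Z ^+ (m - k) * W ^+ (n - k).

Definition bchermite (m n : nat) (Z : BC) : BC := bchermite2 m n Z (bcstar Z).

End BicomplexRing.

Section Gauss.
Variable R : realType.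
Local Notation C := R[i].
Local Notation plane := (measurableTypeR R * measurableTypeR R)%type.

(* C is measured through its identification with the plane. *)
Definition cpt (p : plane) : C := p.1 +i* p.2.

Definition gauss_density (p : plane) : R := pi^-1 * expR (- normc (cpt p) ^+ 2).

Definition gaussC (A : set plane) : \bar R :=
  (\int[lebesgue_measure \x lebesgue_measure]_(p in A) (gauss_density p)%:E)%E.

Lemma gauss_density_ge0 p : 0 <= gauss_density p.
Proof. by rewrite mulr_ge0 ?invr_ge0 ?pi_ge0 ?expR_ge0. Qed.

Lemma gauss_densityE p : gauss_density p = pi^-1 * expR (- (p.1 ^+ 2 + p.2 ^+ 2)).
Proof. by rewrite /gauss_density /normc /= sqr_sqrtr ?addr_ge0 ?sqr_ge0. Qed.

Lemma measurable_gauss_density : measurable_fun [set: plane] gauss_density.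
Proof.
rewrite (_ : gauss_density = fun p => pi^-1 * expR (- (p.1 ^+ 2 + p.2 ^+ 2))).
  2: by apply/funext => p; exact: gauss_densityE.
apply: measurable_funM => //; apply: measurableT_comp => //.
apply: measurableT_comp => //; apply: measurable_funD.
  by apply: measurable_funX; exact: measurable_fst.
by apply: measurable_funX; exact: measurable_snd.
Qed.

Let gaussC0 : gaussC set0 = 0%E.
Proof. by rewrite /gaussC integral_set0. Qed.

Let gaussC_ge0 A : (0 <= gaussC A)%E.
Proof. by apply: integral_ge0 => p _; rewrite lee_fin gauss_density_ge0. Qed.

Let gaussC_sigma_additive : semi_sigma_additive gaussC.
Proof.
apply: (@semi_sigma_additive_nng_induced _ _ _ _ (EFin \o gauss_density)) => [|p].
  by apply/measurable_EFinP; exact: measurable_gauss_density.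
by rewrite lee_fin gauss_density_ge0.
Qed.

HB.instance Definition _ := isMeasure.Build _ _ _
  gaussC gaussC0 gaussC_ge0 gaussC_sigma_additive.

End Gauss.

Arguments gaussC {R} A.

Section SplitSpace.
Variable R : realType.
Local Notation C := R[i].
Local Notation BC := (bicomplex R).
Local Notation plane := (measurableTypeR R * measurableTypeR R)%type.

Definition cnormL2 (f : C -> C) : \bar R :=
  ('N[gaussC]_2%:E[(fun p => (normc (f (cpt p)))%:E)])%E.

(* Functions stand for their classes modulo almost everywhere equality. *)
Definition inL2 (f : C -> C) : Prop :=
  [/\ measurable_fun [set: plane] (fun p => complex.Re (f (cpt p))),
      measurable_fun [set: plane] (fun p => complex.Im (f (cpt p))) &
      (cnormL2 f < +oo)%E].

Definition cinner (f g : C -> C) : C :=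
  let h (p : plane) := f (cpt p) * conjc (g (cpt p)) in
  Complex (\int[gaussC]_p complex.Re (h p)) (\int[gaussC]_p complex.Im (h p)).

Definition inL2split (f : BC -> BC) : Prop :=
  exists f1 f2 : C -> C, [/\ inL2 f1, inL2 f2 &
    forall l1 l2, f (bcsplit l1 l2) = bcsplit (f1 l1) (f2 l2)].

(* The two components of a split function; they are the f1 and f2 of
   [inL2split], and the value chosen for the other variable is irrelevant. *)
Definition comp1 (f : BC -> BC) (l : C) : C := lam1 (f (bcsplit l 0)).
Definition comp2 (f : BC -> BC) (l : C) : C := lam2 (f (bcsplit 0 l)).

Lemma comp_split f (f1 f2 : C -> C) :
  (forall l1 l2, f (bcsplit l1 l2) = bcsplit (f1 l1) (f2 l2)) ->
  comp1 f = f1 /\ comp2 f = f2.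
Proof.
by move=> fE; split; apply/funext => l; rewrite /comp1 /comp2 fE
  ?lam1_split ?lam2_split.
Qed.

Definition inner_split (f g : BC -> BC) : BC :=
  bcsplit (cinner (comp1 f) (comp1 g)) (cinner (comp2 f) (comp2 g)).

Definition normsq_split (f : BC -> BC) : BC := inner_split f f.

(* Unconditional convergence, along the finite subsets of the index set, in
   L^2 in each component. *)
Definition expands (I : choiceType) (h : I -> BC -> BC) (f : BC -> BC)
    (gamma : I -> BC) : Prop :=
  let rest (A : {fset I}) Z := f Z - \sum_(k <- A) h k Z * gamma k in
  (cnormL2 (comp1 (rest A)) @[A --> totally] --> 0%E) /\
  (cnormL2 (comp2 (rest A)) @[A --> totally] --> 0%E).

Definition orthogonal_basis (I : choiceType) (h : I -> BC -> BC) : Prop :=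
  [/\ forall k, inL2split (h k),
      forall k l, k != l -> inner_split (h k) (h l) = 0 &
      forall f, inL2split f -> exists! gamma : I -> BC, expands h f gamma].

End SplitSpace.

(* Main.v *)
Require Import Defs.
From mathcomp Require Import all_boot all_order all_algebra finmap.
From mathcomp Require Import all_classical all_reals all_analysis.
From mathcomp Require Import showcase.summability.
From mathcomp.real_closed Require Import complex.
From mathcomp Require Import measurable_realfun ring lra zify.

(** In the idempotent components, the polynomial [bchermite m n] is the complex
    Hermite polynomial [hermite m n] of each component, because [lam1] and [lam2]
    are ring morphisms that turn the star into complex conjugation.  The inner
    product and the convergence are componentwise as well, so the theorem says
    twice that the complex Hermite polynomials are an orthogonal basis of the
    Gaussian L^2 space of the plane, with squared norms [m! n!].

    Orthogonality ([hpairE]).  For a polynomial P, integration by parts against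
    the Gaussian gives [E (z P) = E (dP / dzbar)].  Hermite polynomials satisfy
    [H_(m+1,n) = z H_(m,n) - n H_(m,n-1)] and [dH_(m,n) / dzbar = n H_(m,n-1)],
    hence [E (H_(m+1,n) H_(a,b)) = b E (H_(m,n) H_(a,b-1))], and the conjugate
    identity holds in the other pair of indices.  Since the conjugate of
    [H_(a,b)] is [H_(b,a)], all inner products follow by descent on the indices.
    Only monomials have to be integrated by parts ([stein_z]), and for these the
    formula is a consequence of the recursion for the moments of a real Gaussian
    variable.

    Expansion.  For an orthogonal family, the distance from f to a finite
    combination is given exactly by [pythagoras].  It follows that the Fourier
    coefficients are the only possible ones, and that the expansion of f
    converges along finite index sets as soon as f lies in the closed span.  It
    remains to see that the closed span is everything ([hspan_full]).

    Completeness.  The closed span contains all monomials in z and zbar.  Call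
    multiplier a bounded measurable real function whose product with every
    monomial stays in the closed span.  Multipliers form an algebra that is
    closed under bounded pointwise limits, by dominated convergence, and hence
    under the exponential.  For a real affine coordinate x, the Taylor series of
    [exp (- x ^ 2 / 16)] is dominated by [exp (x ^ 2 / 16)], whose products with
    monomials are square integrable, so that Gaussians in x are multipliers.
    Their sublevel sets are complements of strips; pointwise limits give the
    indicators of these, then of half-planes, and the sets whose indicator is a
    multiplier form a sigma-algebra, so all Borel sets occur.  Simple functions
    and one more dominated convergence reach every square integrable function. *)

Set Implicit Arguments.
Unset Strict Implicit.
Unset Printing Implicit Defensive.

Import Order.TTheory GRing.Theory Num.Theory.
Import numFieldNormedType.Exports.
Import Normc.

Local Open Scope classical_set_scope.
Local Open Scope ring_scope.
Local Open Scope complex_scope.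

(** * Integration against a density *)

Section density.
Import HBNNSimple.
Local Open Scope ereal_scope.

(** Both sides are limits along the same increasing simple functions, and on
    level sets they agree by definition of the density. *)
Lemma ge0_integral_density d (T : measurableType d) (R : realType)
    (mu nu : {measure set T -> \bar R}) (w : T -> R) (f : T -> \bar R) :
  measurable_fun setT w -> (forall x, (0 <= w x)%R) ->
  (forall A, measurable A -> nu A = \int[mu]_(x in A) (w x)%:E) ->
  measurable_fun setT f -> (forall x, 0 <= f x) ->
  \int[nu]_x f x = \int[mu]_x (f x * (w x)%:E).
Proof.
move=> mw w0 nuE mf f0.
pose h := nnsfun_approx measurableT mf.
have hf x : (EFin \o h n) x @[n --> \oo] --> f x by exact: cvg_nnsfun_approx.
have hnd x m n : (m <= n)%N -> (h m x <= h n x)%R.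
  by move=> mn; exact/lefP/nd_nnsfun_approx.
have mwE : measurable_fun setT (EFin \o w) by exact/measurable_EFinP.
have lim1 : (\int[nu]_x (EFin \o h n) x) @[n --> \oo] --> \int[nu]_x f x.
  have -> : \int[nu]_x f x = \int[nu]_x limn (fun n => (EFin \o h n) x).
    by apply: eq_integral => x _; apply/esym/cvg_lim => //; exact: hf.
  apply: cvg_monotone_convergence => //.
  - by move=> n; exact/measurable_EFinP.
  - by move=> n x _; rewrite lee_fin.
  - by move=> x _ m n mn; rewrite lee_fin; exact: hnd.
have lim2 : (\int[mu]_x ((EFin \o h n) x * (w x)%:E)) @[n --> \oo] -->
    \int[mu]_x (f x * (w x)%:E).
  have -> : \int[mu]_x (f x * (w x)%:E) =
      \int[mu]_x limn (fun n => (EFin \o h n) x * (w x)%:E).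
    apply: eq_integral => x _; apply/esym/cvg_lim => //.
    by apply: cvgeZr => //; exact: hf.
  apply: cvg_monotone_convergence => //.
  - move=> n; apply: emeasurable_funM => //; exact/measurable_EFinP.
  - by move=> n x _; rewrite mule_ge0 ?lee_fin.
  - by move=> x _ m n mn; rewrite lee_wpmul2r ?lee_fin//; exact: hnd.
suff E n : \int[nu]_x (EFin \o h n) x = \int[mu]_x ((EFin \o h n) x * (w x)%:E).
  apply: cvg_unique lim1 _ => //.
  by apply: cvg_trans lim2; rewrite (funext E).
transitivity (\sum_(y \in range (h n)) (y%:E * nu (h n @^-1` [set y]))).
  under eq_integral do rewrite /= fimfunE -fsumEFin//.
  rewrite ge0_integral_fsum//; last 2 first.
  - by move=> y; apply/measurable_EFinP; exact: measurable_funM.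
  - by move=> y x _; exact: nnfun_muleindic_ge0.
  apply: eq_fsbigr => y _.
  by rewrite integralZl_indic_nnsfun// integral_indic// setIT.
transitivity (\sum_(y \in range (h n))
    \int[mu]_x (y%:E * ((\1_(h n @^-1` [set y]) x)%:E * (w x)%:E))).
  apply: eq_fsbigr => y /set_mem[x _ <-].
  rewrite ge0_integralZl//; last 3 first.
  - apply: emeasurable_funM => //; apply/measurable_EFinP.
    exact: measurable_indic.
  - by move=> t _; rewrite mule_ge0 ?lee_fin.
  - by rewrite lee_fin.
  rewrite nuE//; congr (_ * _).
  rewrite integral_mkcond; apply: eq_integral => t _.
  by rewrite patchE indicE; case: ifPn => _; rewrite ?mul1e ?mul0e.
rewrite -ge0_integral_fsum//; last 2 first.
- move=> y; apply: emeasurable_funM => //; apply: emeasurable_funM => //.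
  by apply/measurable_EFinP; exact: measurable_indic.
- move=> y x _; rewrite muleA mule_ge0 ?lee_fin//.
  exact: nnfun_muleindic_ge0.
apply: eq_integral => x _ /=.
rewrite [in RHS]fimfunE -fsumEFin// ge0_mule_fsuml; last first.
  by move=> y; exact: nnfun_muleindic_ge0.
by apply: eq_fsbigr => y _; rewrite EFinM muleA.
Qed.

End density.

(** * One-dimensional Gaussian moments *)

Section growth.
Variable R : realType.

Lemma pow_le_expR (c : R) k : 0 < c ->
  exists2 C : R, 0 <= C & forall s, 0 <= s -> s ^+ k <= C * expR (c * s).
Proof.
move=> c0; case: k => [|k].
  exists 1 => // s s0; rewrite expr0 mul1r -expR0 ler_expR.
  by rewrite mulr_ge0// ltW.
exists (k.+1`!%:R / c ^+ k.+1) => [|s s0].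
  by rewrite divr_ge0// exprn_ge0// ltW.
have cs0 : 0 <= c * s by rewrite mulr_ge0// ltW.
rewrite mulrAC ler_pdivlMr ?exprn_gt0// -exprMn [s * c]mulrC.
rewrite [leRHS]mulrC -ler_pdivrMr ?ltr0n ?fact_gt0//.
by apply: le_trans (expR_ge1Dxn k cs0); rewrite lerDr.
Qed.

(** The bound on a power of [x ^ 2] gives the even exponent [2 k]; the exponent [k]
    follows from [t <= 1 + t ^ 2]. *)
Lemma norm_pow_le_expR (c : R) k : 0 < c ->
  exists2 C : R, 0 <= C & forall x, `|x| ^+ k <= C * expR (c * x ^+ 2).
Proof.
move=> c0; have [C C0 HC] := pow_le_expR k c0.
exists (1 + C) => [|x]; first by rewrite addr_ge0.
have := HC _ (sqr_ge0 x); rewrite -exprM mulnC exprM => HCx.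
have e1 : 1 <= expR (c * x ^+ 2).
  by rewrite -expR0 ler_expR mulr_ge0 ?sqr_ge0// ltW.
have xk : `|x| ^+ k <= 1 + (x ^+ k) ^+ 2.
  by rewrite -normrX -(real_normK (num_real (x ^+ k))); nra.
by rewrite mulrDl mul1r; lra.
Qed.

Local Notation mu := (@lebesgue_measure R).

Definition half_gauss (x : R) := expR (- (x ^+ 2 / 2)).

Lemma half_gaussE : half_gauss = normal_fun 0 1.
Proof.
by apply/funext => x; rewrite /normal_fun /half_gauss subr0 expr1n mulNr.
Qed.

Lemma integrable_half_gauss : mu.-integrable setT (EFin \o half_gauss).
Proof.
have := @integrable_normal_pdf R 0 1.
rewrite normal_pdfE ?oner_neq0//= -half_gaussE => int.
have pk : normal_peak (1 : R) != 0.
  by rewrite gt_eqF// normal_peak_gt0// oner_neq0.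
have -> : EFin \o half_gauss = fun x => ((normal_peak 1)^-1%:E *
     (normal_peak 1 * half_gauss x)%:E)%E.
  by apply/funext => x /=; rewrite -EFinM mulrA mulVf// mul1r.
exact: integrableZl.
Qed.

End growth.

Section moments.
Variable R : realType.
Local Notation mu := (@lebesgue_measure R).

Lemma measurable_gauss_moment k :
  measurable_fun setT (fun x : R => x ^+ k * gauss_fun x).
Proof. by apply: measurable_funM => //; exact: measurable_gauss_fun. Qed.

(** Half of the Gaussian decay absorbs the power of [x]. *)
Lemma gauss_moment_le k : exists2 C : R, 0 <= C &
  forall x, `|x ^+ k * gauss_fun x| <= C * half_gauss x.
Proof.
have c0 : 0 < 2^-1 :> R by rewrite invr_gt0.
have [C C0 HC] := norm_pow_le_expR k c0.
exists C => // x; rewrite normrM normrX (ger0_norm (gauss_fun_ge0 x)).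
apply: le_trans (ler_wpM2r (gauss_fun_ge0 x) (HC x)) _.
rewrite -mulrA -expRD ler_wpM2l// ler_expR.
by rewrite le_eqVlt; apply/orP; left; apply/eqP; field.
Qed.

Lemma integrable_gauss_moment k :
  mu.-integrable setT (fun x : R => (x ^+ k * gauss_fun x)%:E).
Proof.
have [C C0 HC] := gauss_moment_le k.
have int := integrableZl measurableT C (@integrable_half_gauss R).
apply: le_integrable int => //.
- by apply/measurable_EFinP; exact: measurable_gauss_moment.
- move=> x _; rewrite /= lee_fin.
  by apply: le_trans (HC x) _; exact: ler_norm.
Qed.

Definition gauss_moment k : R := \int[mu]_x (x ^+ k * gauss_fun x).

Lemma gauss_moment0 : gauss_moment 0 = Num.sqrt pi.
Proof.
rewrite /gauss_moment /Rintegral; under eq_integral do rewrite expr0 mul1r.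
by rewrite integralT_gauss.
Qed.

(* f k is the derivative of F k; its integral over the line is the difference
   of the two sides of the moment recursion. *)
Let F k (x : R) := x ^+ k * gauss_fun x.
Let f k (x : R) := k%:R * (x ^+ k.-1 * gauss_fun x) - 2 * (x ^+ k.+1 * gauss_fun x).

Let is_derive_F k (x : R) : is_derive x (1:R) (F k) (f k x).
Proof.
have dF : is_derive x (1:R) (fun x : R => - x ^+ 2) (- (2 * x)).
  have -> : (fun x : R => - x ^+ 2) = - (id ^+ 2) by [].
  by apply: is_derive_eq; rewrite /GRing.scale/= expr1 mulr1.
have de : is_derive x (1:R) (@gauss_fun R) (- (2 * x) * gauss_fun x).
  have -> : @gauss_fun R = expR \o (fun x : R => - x ^+ 2) by [].
  have := @is_derive1_comp R expR (fun x => - x ^+ 2) x _ _ _ dF.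
  by move=> /(_ _ (is_derive_expR _)); rewrite mulrC.
have -> : F k = (id ^+ k : R -> R) * @gauss_fun R.
  by apply/funext => y; rewrite /F mulrfctE exprfctE.
apply: is_derive_eq; rewrite /f /GRing.scale/= mulr1 exprS exprfctE.
by ring.
Qed.

Let continuous_f k : continuous (f k).
Proof.
have cX n : continuous (fun x : R => x ^+ n * gauss_fun x).
  move=> x; apply: (@continuousM _ R (fun x => x ^+ n) (@gauss_fun R)).
    exact: exprn_continuous.
  exact: continuous_gauss_fun.
by move=> x; apply: cvgB; (apply: cvgM; [exact: cvg_cst|exact: cX]).
Qed.

Let integrable_f k : mu.-integrable setT (EFin \o f k).
Proof.
have -> : EFin \o f k = fun x => ((k%:R)%:E * (x ^+ k.-1 * gauss_fun x)%:E -
    2%:E * (x ^+ k.+1 * gauss_fun x)%:E)%E by [].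
apply: integrableB => //; apply: integrableZl => //; exact: integrable_gauss_moment.
Qed.

Let int_f k (n : nat) : (0 < n)%N ->
  (\int[mu]_(x in `[(- n%:R)%R, n%:R%R]) (f k x)%:E = (F k n%:R - F k (- n%:R))%R%:E)%E.
Proof.
move=> n0; rewrite EFinB; apply: continuous_FTC2.
- by rewrite ltrNl; apply: (@lt_trans _ _ 0); rewrite ?oppr_lt0 ltr0n.
- by apply: continuous_subspaceT; exact: continuous_f.
- have cF : continuous (F k).
    move=> x; apply/differentiable_continuous/derivable1_diffP.
    exact: (@ex_derive _ _ _ _ _ _ _ (is_derive_F k x)).
  split=> [x _||]; first exact: (@ex_derive _ _ _ _ _ _ _ (is_derive_F k x)).
    exact/cvg_at_right_filter/cF.
  exact/cvg_at_left_filter/cF.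
- move=> x _; rewrite derive1E.
  exact: (@derive_val _ _ _ _ _ _ _ (is_derive_F k x)).
Qed.

Let cvg_int_f k : (\int[mu]_(x in `[(- n%:R)%R, n%:R%R]) (f k x)%:E)%E @[n --> \oo] -->
  (\int[mu]_x (f k x)%:E)%E.
Proof.
pose fn (n : nat) := (EFin \o f k) \_ (`[- n%:R, n%:R]).
have mf : measurable_fun setT (EFin \o f k) by exact: measurable_int (integrable_f k).
have mfn n : measurable_fun setT (fn n).
  by apply/(measurable_restrictT _ _).1 => //; exact: measurable_funTS.
have fnf : {ae mu, forall x, setT x -> fn ^~ x @ \oo --> (EFin \o f k) x}.
  apply/nearW => x _; apply: cvg_near_cst.
  near=> n; rewrite /fn patchE ifT// inE/= in_itv/= -ler_norml.
  near: n; exact: nbhs_infty_ger.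
have ifn : mu.-integrable setT (abse \o (EFin \o f k)).
  by apply: integrable_abse.
have fng : {ae mu, forall x n, setT x -> (`|fn n x| <= (abse \o (EFin \o f k)) x)%E}.
  apply/nearW => x n _; rewrite /fn patchE; case: ifPn => _ //.
  by rewrite abse0 abse_ge0.
have [_ _ H] := @dominated_convergence _ (measurableTypeR R) R mu setT measurableT
  fn (EFin \o f k) _ mfn mf fnf ifn fng.
apply: cvg_trans H; apply: near_eq_cvg; apply/nearW => n.
by rewrite integral_mkcond.
Unshelve. all: by end_near. Qed.

Let cvg_boundary k : (F k n%:R - F k (- n%:R)) @[n --> \oo] --> (0 : R).
Proof.
have [C C0 HC] := gauss_moment_le k.+1.
have FC x : x != 0 -> `|F k x| <= C / `|x|.
  move=> x0; rewrite ler_pdivlMr ?normr_gt0// -normrM.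
  (* x * F k x = F k.+1 x is bounded, so F k decays at least like 1 / x. *)
  rewrite mulrC /F mulrA -exprS (le_trans (HC x))// ler_piMr//.
  by rewrite -expR0 ler_expR oppr_le0 divr_ge0 ?sqr_ge0.
apply/norm_cvg0P.
have inv0 : ((C + C) * (n%:R : R)^-1) @[n --> \oo] --> (0 : R).
  rewrite -[X in _ --> X](mulr0 (C + C)); apply: cvgMl_tmp.
  apply/gtr0_cvgV0; first by near=> n; rewrite ltr0n; near: n; exists 1%N.
  exact: cvgr_idn.
apply: squeeze_cvgr (cvg_cst 0) inv0.
near=> n; rewrite normr_ge0/=.
have n0 : n%:R != 0 :> R.
  by rewrite pnatr_eq0 -lt0n; near: n; exists 1%N.
apply: le_trans (ler_normB _ _) _; rewrite mulrDl lerD//.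
  by apply: le_trans (FC _ n0) _; rewrite ger0_norm.
by apply: le_trans (FC _ _) _; rewrite ?oppr_eq0// normrN ger0_norm.
Unshelve. all: by end_near. Qed.

(** The function [x ^ k * exp (- x ^ 2)] vanishes at both ends of the line, hence
    its derivative has integral 0.  For [k = 0] this says that the first moment
    vanishes, the value [k.-1 = 0] being multiplied by 0. *)
Lemma gauss_moment_rec k :
  2 * gauss_moment k.+1 = k%:R * gauss_moment k.-1.
Proof.
have int0 : (\int[mu]_x (f k x)%:E)%E = 0%E.
  apply: cvg_unique (@cvg_int_f k) _ => //.
  have B : (F k n%:R - F k (- n%:R))%:E @[n --> \oo] --> 0%E.
    by apply: cvg_EFin; [exact: nearW|exact: cvg_boundary].
  apply: cvg_trans B.
  apply: near_eq_cvg; near=> n; rewrite int_f//.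
  by near: n; exists 1%N.
apply/eqP; rewrite eq_sym -subr_eq0; apply/eqP.
rewrite -!RintegralZl//; try exact: integrable_gauss_moment.
rewrite -RintegralB//; last 2 first.
- have := integrableZl measurableT k%:R (integrable_gauss_moment k.-1).
  by apply: eq_integrable.
- have := integrableZl measurableT 2 (integrable_gauss_moment k.+1).
  by apply: eq_integrable.
by rewrite /Rintegral int0.
Unshelve. all: by end_near. Qed.

End moments.

(** * The Gaussian measure of the plane *)

Section plane_gauss.
Variable R : realType.
Local Notation C := R[i].
Local Notation plane := (measurableTypeR R * measurableTypeR R)%type.
Local Notation mu := (@lebesgue_measure R).
Local Notation mu2 := (mu \x mu)%E.

Lemma integral_gaussC (f : plane -> \bar R) : measurable_fun setT f ->
  (\int[gaussC]_p f p = \int[mu2]_p (f p * (gauss_density p)%:E))%E.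
Proof.
move=> mf.
have wE (g : plane -> \bar R) : measurable_fun setT g -> (forall p, 0 <= g p)%E ->
    (\int[gaussC]_p g p = \int[mu2]_p (g p * (gauss_density p)%:E))%E.
  by move=> mg g0; apply: ge0_integral_density => //;
    [exact: measurable_gauss_density|exact: gauss_density_ge0].
rewrite [LHS]integralE [RHS]integralE !wE//; last 2 first.
- exact: measurable_funeneg.
- exact: measurable_funepos.
congr (_ - _)%E; apply: eq_integral => p _.
  rewrite muleC; have := ge0_funeposM f (gauss_density_ge0 p).
  move=> /(congr1 (@^~ p)) /= <-.
  by rewrite !funeposE muleC.
rewrite muleC; have := ge0_funenegM f (gauss_density_ge0 p).
move=> /(congr1 (@^~ p)) /= <-.
by rewrite !funenegE muleC.
Qed.

Lemma gauss_density_gauss (p : plane) :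
  gauss_density p = pi^-1 * (gauss_fun p.1 * gauss_fun p.2).
Proof. by rewrite gauss_densityE opprD expRD. Qed.

Lemma integral_prodfun (g h : R -> R) :
  mu.-integrable setT (EFin \o g) -> mu.-integrable setT (EFin \o h) ->
  mu2.-integrable setT (fun p : plane => (g p.1 * h p.2)%:E) /\
  (\int[mu2]_p (g p.1 * h p.2)%:E = ((\int[mu]_x g x) * (\int[mu]_x h x))%:E)%E.
Proof.
move=> ig ih.
have mg : measurable_fun setT (g : measurableTypeR R -> R).
  by apply/measurable_EFinP; exact: measurable_int ig.
have mh : measurable_fun setT (h : measurableTypeR R -> R).
  by apply/measurable_EFinP; exact: measurable_int ih.
have mgh : measurable_fun setT (fun p : plane => (g p.1 * h p.2)%:E).
  apply/measurable_EFinP; apply: measurable_funM.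
    by apply: measurableT_comp => //; exact: measurable_fst.
  by apply: measurableT_comp => //; exact: measurable_snd.
have igh : mu2.-integrable setT (fun p : plane => (g p.1 * h p.2)%:E).
  apply/integrable12ltyP => //=.
  have -> : (\int[mu]_x \int[mu]_y `|(g x * h y)%:E| =
     \int[mu]_x (`|g x|%:E * \int[mu]_y `|h y|%:E))%E.
    apply: eq_integral => x _; rewrite -ge0_integralZl//; last first.
      by apply/measurable_EFinP; exact: measurableT_comp.
    by apply: eq_integral => y _; rewrite /= normrM EFinM.
  have fh : (\int[mu]_y `|h y|%:E)%E \is a fin_num.
    by apply: integrable_fin_num => //; apply: (integrable_abse ih).
  rewrite -(fineK fh) ge0_integralZr//; last 2 first.
  - by apply/measurable_EFinP; exact: measurableT_comp.
  - by rewrite lee_fin fine_ge0// integral_ge0.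
  rewrite fineK//.
  have fg : (\int[mu]_y `|g y|%:E)%E \is a fin_num.
    by apply: integrable_fin_num => //; apply: (integrable_abse ig).
  by rewrite -(fineK fg) -(fineK fh) -EFinM ltry.
split=> //.
rewrite -integral12_prod_meas1//=.
rewrite /fubini_F/=.
have -> : (\int[mu]_x \int[mu]_y (g x * h y)%:E =
     \int[mu]_x ((\int[mu]_y h y)%:E * (g x)%:E))%E.
  apply: eq_integral => x _; rewrite /Rintegral fineK; last first.
    exact: (integrable_fin_num measurableT ih).
  rewrite muleC -integralZl//.
rewrite integralZl// /Rintegral -(fineK (integrable_fin_num measurableT ig)).
by rewrite -EFinM mulrC.
Qed.

Definition sqdist (p : plane) : R := p.1 ^+ 2 + p.2 ^+ 2.

Lemma sqdistE p : sqdist p = normc (cpt p) ^+ 2.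
Proof. by rewrite /normc /= sqr_sqrtr ?addr_ge0 ?sqr_ge0. Qed.

Lemma measurable_sqdist : measurable_fun setT sqdist.
Proof.
by apply: measurable_funD; apply: measurable_funX;
  [exact: measurable_fst|exact: measurable_snd].
Qed.

(** The density leaves [exp (- |p| ^ 2 / 2)], a product of two integrable
    Gaussians.  Square integrability of the functions below is obtained by
    comparison with this one. *)
Lemma integrable_exp_sqdist :
  gaussC.-integrable setT (fun p : plane => (expR (sqdist p / 2))%:E).
Proof.
have m1 : measurable_fun setT (fun p : plane => (expR (sqdist p / 2))%:E).
  apply/measurable_EFinP; apply: measurableT_comp => //.
  by apply: measurable_funM => //; exact: measurable_sqdist.
apply/integrableP; split => //.
under eq_integral do rewrite gee0_abs ?lee_fin ?expR_ge0//.
rewrite integral_gaussC//.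
have [int E] := integral_prodfun (@integrable_half_gauss R) (@integrable_half_gauss R).
have -> : (\int[mu2]_p ((expR (sqdist p / 2))%:E * (gauss_density p)%:E) =
    \int[mu2]_p ((pi^-1)%R%:E * (half_gauss p.1 * half_gauss p.2)%:E))%E.
  apply: eq_integral => p _; rewrite -!EFinM; congr EFin.
  rewrite gauss_densityE mulrCA; congr (_ * _).
  by rewrite -!expRD; congr expR; rewrite /sqdist; field.
rewrite [ltLHS](_ : _ = (pi^-1)%R%:E *
    \int[mu2]_p (half_gauss p.1 * half_gauss p.2)%:E)%E.
  by rewrite E -EFinM ltry.
exact: (integralZl measurableT int pi^-1).
Qed.

(** Moments of the probability measure of density [exp (- x ^ 2) / sqrt pi]. *)
Definition moment (k : nat) : R := gauss_moment R k / Num.sqrt pi.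

Lemma moment0 : moment 0 = 1.
Proof. by rewrite /moment gauss_moment0 divff// gt_eqF// sqrtr_gt0 pi_gt0. Qed.

Lemma moment_rec k : 2 * moment k.+1 = k%:R * moment k.-1.
Proof. by rewrite /moment !mulrA gauss_moment_rec. Qed.

Lemma integral_gaussC_monomial (i j : nat) :
  \int[gaussC]_p (p.1 ^+ i * p.2 ^+ j) = moment i * moment j :> R.
Proof.
rewrite /Rintegral integral_gaussC; last first.
  apply/measurable_EFinP; apply: measurable_funM; apply: measurable_funX.
    exact: measurable_fst.
  exact: measurable_snd.
have [int E] := integral_prodfun (@integrable_gauss_moment R i)
  (@integrable_gauss_moment R j).
have -> : (\int[mu2]_p ((p.1 ^+ i * p.2 ^+ j)%:E * (gauss_density p)%:E) =
    \int[mu2]_p ((pi^-1)%R%:E * ((p.1 ^+ i * gauss_fun p.1) * (p.2 ^+ j * gauss_fun p.2))%:E))%E.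
  apply: eq_integral => p _; rewrite -!EFinM; congr EFin.
  by rewrite gauss_density_gauss; ring.
set I := (X in fine X); have -> : I = ((pi^-1)%R%:E *
    \int[mu2]_p ((p.1 ^+ i * gauss_fun p.1) * (p.2 ^+ j * gauss_fun p.2))%:E)%E.
  exact: (integralZl measurableT int pi^-1).
rewrite E.
rewrite -EFinM /= /moment /gauss_moment.
have pE : pi = Num.sqrt pi ^+ 2 :> R by rewrite sqr_sqrtr// pi_ge0.
have p0 : Num.sqrt pi != 0 :> R by rewrite gt_eqF// sqrtr_gt0 pi_gt0.
by rewrite {1}pE; field.
Qed.

End plane_gauss.

(** * Complex-valued square integrable functions *)

Section complex_L2.
Variable R : realType.
Local Notation C := R[i].
Local Notation plane := (measurableTypeR R * measurableTypeR R)%type.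
Implicit Types (f g h : C -> C) (z : C).

Lemma normc_sqE z : normc z ^+ 2 = complex.Re z ^+ 2 + complex.Im z ^+ 2.
Proof. by case: z => a b; rewrite /normc sqr_sqrtr ?addr_ge0 ?sqr_ge0. Qed.

Lemma mulcJ z : z * conjc z = (normc z ^+ 2)%:C.
Proof.
rewrite normc_sqE; case: z => a b; apply/eqP; rewrite eq_complex /=.
by apply/andP; split; apply/eqP; ring.
Qed.

Lemma normc_ge0 z : 0 <= normc z.
Proof. by case: z => a b; exact: sqrtr_ge0. Qed.

Lemma normc_real (r : R) : normc (r%:C) = `|r|.
Proof. by rewrite /normc /= expr0n /= addr0 sqrtr_sqr. Qed.

Lemma normcX z n : normc (z ^+ n) = normc z ^+ n.
Proof. by elim: n => [|n IH]; rewrite ?normc1// !exprS normcM IH. Qed.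

Lemma normc_conjc z : normc (conjc z) = normc z.
Proof. by case: z => a b; rewrite /normc /= sqrrN. Qed.

Lemma normcD_sq_le z w :
  normc (z + w) ^+ 2 <= 2 * normc z ^+ 2 + 2 * normc w ^+ 2.
Proof.
rewrite !normc_sqE; case: z w => a b [c d] /=.
have := sqr_ge0 (a - c); have := sqr_ge0 (b - d); nra.
Qed.

Definition cmeas f := measurable_fun setT (fun p : plane => complex.Re (f (cpt p))) /\
  measurable_fun setT (fun p : plane => complex.Im (f (cpt p))).

Lemma ReD z w : complex.Re (z + w) = complex.Re z + complex.Re w.
Proof. by case: z w => a b []. Qed.
Lemma ImD z w : complex.Im (z + w) = complex.Im z + complex.Im w.
Proof. by case: z w => a b []. Qed.
Lemma ReM z w : complex.Re (z * w) =
  complex.Re z * complex.Re w - complex.Im z * complex.Im w.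
Proof. by case: z w => a b []. Qed.
Lemma ImM z w : complex.Im (z * w) =
  complex.Re z * complex.Im w + complex.Im z * complex.Re w.
Proof. by case: z w => a b []. Qed.
Lemma ReJ z : complex.Re (conjc z) = complex.Re z. Proof. by case: z. Qed.
Lemma ImJ z : complex.Im (conjc z) = - complex.Im z. Proof. by case: z. Qed.

Lemma cmeas_cst z : cmeas (fun=> z).
Proof. by split; exact: measurable_cst. Qed.

Lemma cmeas_id : cmeas id.
Proof. by split => /=; [exact: measurable_fst|exact: measurable_snd]. Qed.

Lemma cmeas_conj f : cmeas f -> cmeas (fun l => conjc (f l)).
Proof.
move=> [mr mi]; split; first by under eq_fun do rewrite ReJ.
by under eq_fun do rewrite ImJ; exact: measurableT_comp.
Qed.

Lemma cmeasD f g : cmeas f -> cmeas g -> cmeas (fun l => f l + g l).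
Proof.
move=> [fr fi] [gr gi]; split.
  by under eq_fun do rewrite ReD; exact: measurable_funD.
by under eq_fun do rewrite ImD; exact: measurable_funD.
Qed.

Lemma cmeasM f g : cmeas f -> cmeas g -> cmeas (fun l => f l * g l).
Proof.
move=> [fr fi] [gr gi]; split.
  by under eq_fun do rewrite ReM; apply: measurable_funB; exact: measurable_funM.
by under eq_fun do rewrite ImM; apply: measurable_funD; exact: measurable_funM.
Qed.

Lemma cmeasZ z f : cmeas f -> cmeas (fun l => z * f l).
Proof. exact/cmeasM/cmeas_cst. Qed.

Lemma cmeasX f n : cmeas f -> cmeas (fun l => f l ^+ n).
Proof.
move=> mf; elim: n => [|n IH]; first exact: cmeas_cst.
by under eq_fun do rewrite exprS; exact: cmeasM.
Qed.

Lemma cmeas_real (u : C -> R) :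
  measurable_fun setT (fun p : plane => u (cpt p)) -> cmeas (fun l => (u l)%:C).
Proof. by move=> mu; split => //=; exact: measurable_cst. Qed.

(** The square modulus keeps all integrands real and avoids square roots. *)
Definition sqmod f (p : plane) : R := normc (f (cpt p)) ^+ 2.

Lemma sqmod_ge0 f p : 0 <= sqmod f p. Proof. exact: sqr_ge0. Qed.

Lemma measurable_sqmod f : cmeas f -> measurable_fun setT (sqmod f).
Proof.
move=> [mr mi]; rewrite /sqmod; under eq_fun do rewrite normc_sqE.
by apply: measurable_funD; exact: measurable_funX.
Qed.

Lemma cnormL2E f : cnormL2 f = ((\int[gaussC]_p (sqmod f p)%:E) `^ 2^-1)%E.
Proof.
rewrite /cnormL2 unlock; congr (_ `^ _)%E; apply: eq_integral => p _.
by rewrite /= ger0_norm ?normc_ge0// powR_mulrn// normc_ge0.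
Qed.

(** Working with integrability of the square modulus replaces the extended-real
    norm by the linear theory of integrable functions. *)
Lemma inL2P f : inL2 f <->
  cmeas f /\ gaussC.-integrable setT (EFin \o sqmod f).
Proof.
have E : (\int[gaussC]_p `|(sqmod f p)%:E| = \int[gaussC]_p (sqmod f p)%:E)%E.
  by apply: eq_integral => p _; rewrite gee0_abs// lee_fin sqmod_ge0.
split=> [[mr mi]|[[mr mi] /integrableP[_ fi]]].
  rewrite cnormL2E => fi; have mf : cmeas f by split.
  split => //.
  apply/integrableP; split; first by apply/measurable_EFinP; apply: measurable_sqmod.
  rewrite [X in (X < _)%E]E; move: fi.
  have : (0 <= \int[gaussC]_p (sqmod f p)%:E)%E.
    by apply: integral_ge0 => p _; rewrite lee_fin sqmod_ge0.
  case: (\int[gaussC]_p _)%E => [r _ _||//]; first by rewrite ltry.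
  by rewrite /= invr_eq0 pnatr_eq0.
split => //; rewrite cnormL2E; move: fi; rewrite [X in (X < _)%E -> _]E.
by case: (\int[gaussC]_p _)%E => [r _||_] //=; [|case: ifP => _]; rewrite ltry.
Qed.

Definition sqnormL2 f : R := \int[gaussC]_p sqmod f p.

Lemma sqnormL2_ge0 f : 0 <= sqnormL2 f.
Proof. by apply: Rintegral_ge0 => p _; exact: sqmod_ge0. Qed.

Lemma integral_sqmod f : inL2 f -> (\int[gaussC]_p (sqmod f p)%:E = (sqnormL2 f)%:E)%E.
Proof.
by move=> /inL2P[_ fi]; rewrite /sqnormL2 /Rintegral fineK// integrable_fin_num.
Qed.

Lemma cnormL2_sqnormL2 f : inL2 f -> cnormL2 f = (Num.sqrt (sqnormL2 f))%:E.
Proof.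
by move=> Lf; rewrite cnormL2E integral_sqmod//= powR12_sqrt// sqnormL2_ge0.
Qed.

Lemma inL2_le f g : cmeas f -> inL2 g ->
  (forall l, normc (f l) <= normc (g l)) -> inL2 f.
Proof.
move=> mf /inL2P[_ gi] fg; apply/inL2P; split => //.
apply: le_integrable gi => //; first by apply/measurable_EFinP; apply: measurable_sqmod.
move=> p _; rewrite /= lee_fin !ger0_norm ?sqmod_ge0//.
by rewrite /sqmod lerXn2r ?nnegrE ?normc_ge0.
Qed.

Lemma inL2D f g : inL2 f -> inL2 g -> inL2 (fun l => f l + g l).
Proof.
move=> /inL2P[mf fi] /inL2P[mg gi]; apply/inL2P.
have mfg := cmeasD mf mg; split => //.
have int := integrableD measurableT (integrableZl measurableT 2 fi)
  (integrableZl measurableT 2 gi).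
apply: le_integrable int => //; first by apply/measurable_EFinP; apply: measurable_sqmod.
move=> p _; rewrite /= lee_fin ger0_norm ?sqmod_ge0//.
by apply: le_trans (normcD_sq_le _ _) _; exact: ler_norm.
Qed.

Lemma inL2Z z f : inL2 f -> inL2 (fun l => z * f l).
Proof.
move=> /inL2P[mf fi]; apply/inL2P; split; first exact: cmeasZ.
have int := integrableZl measurableT (normc z ^+ 2) fi.
apply: eq_integrable int => // p _.
by rewrite /sqmod /= normcM exprMn EFinM.
Qed.

Lemma inL2_0 : inL2 (fun=> 0 : C).
Proof.
apply/inL2P; split; first exact: cmeas_cst.
apply: eq_integrable (integrable0 _ _) => // p _.
by rewrite /= /sqmod normc0 expr0n.
Qed.

Lemma inL2N f : inL2 f -> inL2 (fun l => - f l).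
Proof. by move=> /(inL2Z (-1)); under eq_fun do rewrite mulN1r. Qed.

Lemma inL2B f g : inL2 f -> inL2 g -> inL2 (fun l => f l - g l).
Proof. by move=> Lf /inL2N; exact: inL2D. Qed.

Lemma inL2_sum (I : Type) (s : seq I) (h : I -> C -> C) (d : I -> C) :
  (forall k, inL2 (h k)) -> inL2 (fun l => \sum_(k <- s) h k l * d k).
Proof.
move=> Lh; elim: s => [|k s IH].
  by under eq_fun do rewrite big_nil; exact: inL2_0.
under eq_fun do rewrite big_cons mulrC; exact/inL2D/IH/inL2Z.
Qed.

Lemma sqnormL2D_le f g : inL2 f -> inL2 g ->
  sqnormL2 (fun l => f l + g l) <= 2 * sqnormL2 f + 2 * sqnormL2 g.
Proof.
move=> Lf Lg; have /inL2P[_ fgi] := inL2D Lf Lg.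
move: Lf Lg => /inL2P[_ fi] /inL2P[_ gi].
have fi2 := integrableZl measurableT 2 fi.
have gi2 := integrableZl measurableT 2 gi.
rewrite /sqnormL2 -!RintegralZl// -RintegralD//.
apply: le_Rintegral => //.
  by have := integrableD measurableT fi2 gi2; apply: eq_integrable.
by move=> p _; exact: normcD_sq_le.
Qed.

Lemma sqnormL2_le_mul (K : R) f g : 0 <= K -> inL2 f -> inL2 g ->
  (forall l, normc (f l) ^+ 2 <= K * normc (g l) ^+ 2) -> sqnormL2 f <= K * sqnormL2 g.
Proof.
move=> K0 /inL2P[_ fi] /inL2P[_ gi] fg.
rewrite /sqnormL2 -RintegralZl//; apply: le_Rintegral => //.
  by have := integrableZl measurableT K gi; apply: eq_integrable.
by move=> p _; exact: fg.
Qed.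

Definition cintegrable h :=
  gaussC.-integrable setT (fun p : plane => (complex.Re (h (cpt p)))%:E) /\
  gaussC.-integrable setT (fun p : plane => (complex.Im (h (cpt p)))%:E).

(** The complex integral, taken on real and imaginary parts as in [cinner]; it is
    linear over the complex numbers, which the two real integrals do not show. *)
Definition cint h : C :=
  Complex (\int[gaussC]_p complex.Re (h (cpt p)))
          (\int[gaussC]_p complex.Im (h (cpt p))).

Lemma cinnerE f g : cinner f g = cint (fun l => f l * conjc (g l)).
Proof. by []. Qed.

Lemma cintegrableD f g : cintegrable f -> cintegrable g ->
  cintegrable (fun l => f l + g l).
Proof.
move=> [fr fi] [gr gi]; split.
  by apply: eq_integrable (integrableD measurableT fr gr) => // p _; rewrite /= ReD.
by apply: eq_integrable (integrableD measurableT fi gi) => // p _; rewrite /= ImD.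
Qed.

Lemma cintD f g : cintegrable f -> cintegrable g ->
  cint (fun l => f l + g l) = cint f + cint g.
Proof.
move=> [fr fi] [gr gi]; rewrite /cint; congr Complex.
  by under eq_Rintegral do rewrite ReD; rewrite RintegralD.
by under eq_Rintegral do rewrite ImD; rewrite RintegralD.
Qed.

Lemma cintegrableZ z f : cintegrable f -> cintegrable (fun l => z * f l).
Proof.
move=> [fr fi]; split.
  apply: eq_integrable (integrableB measurableT
    (integrableZl measurableT (complex.Re z) fr)
    (integrableZl measurableT (complex.Im z) fi)) => // p _; by rewrite /= ReM.
apply: eq_integrable (integrableD measurableT
    (integrableZl measurableT (complex.Re z) fi)
    (integrableZl measurableT (complex.Im z) fr)) => // p _; by rewrite /= ImM.
Qed.

Lemma cintZ z f : cintegrable f -> cint (fun l => z * f l) = z * cint f.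
Proof.
move=> [fr fi].
have Zi (k : R) u : gaussC.-integrable setT (fun p : plane => (u p)%:E) ->
    gaussC.-integrable setT (fun p : plane => (k * u p)%:E).
  by move=> ui; apply: eq_integrable (integrableZl measurableT k ui).
rewrite /cint; apply/eqP; rewrite eq_complex ReM ImM /=; apply/andP; split; apply/eqP.
  under eq_Rintegral do rewrite ReM.
  by rewrite RintegralB//; [rewrite !RintegralZl|exact: Zi..].
under eq_Rintegral do rewrite ImM.
by rewrite RintegralD//; [rewrite !RintegralZl|exact: Zi..].
Qed.

Lemma cint0 : cint (fun=> 0) = 0.
Proof. by rewrite /cint /= Rintegral_cst// mul0r. Qed.

Lemma cintegrable0 : cintegrable (fun=> 0).
Proof. by split; apply: eq_integrable (integrable0 _ _). Qed.

Lemma cintegrable_sum (I : Type) (s : seq I) (h : I -> C -> C) :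
  (forall k, cintegrable (h k)) -> cintegrable (fun l => \sum_(k <- s) h k l).
Proof.
move=> hi; elim: s => [|k s IH].
  by under eq_fun do rewrite big_nil; exact: cintegrable0.
by under eq_fun do rewrite big_cons; exact: cintegrableD.
Qed.

Lemma cint_sum (I : Type) (s : seq I) (h : I -> C -> C) :
  (forall k, cintegrable (h k)) ->
  cint (fun l => \sum_(k <- s) h k l) = \sum_(k <- s) cint (h k).
Proof.
move=> hi; elim: s => [|k s IH].
  by under eq_fun do rewrite big_nil; rewrite cint0 big_nil.
under eq_fun do rewrite big_cons.
by rewrite cintD// ?big_cons ?IH//; exact: cintegrable_sum.
Qed.

Lemma cint_conj f : cintegrable f -> cint (fun l => conjc (f l)) = conjc (cint f).
Proof.
move=> [fr fi]; rewrite /cint /=; congr Complex.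
  by apply: eq_Rintegral => p _; rewrite ReJ.
under eq_Rintegral do rewrite ImJ -mulN1r.
by rewrite RintegralZl// mulN1r.
Qed.

(** The product is dominated by the sum of the two square moduli. *)
Lemma cintegrable_inner f g : inL2 f -> inL2 g ->
  cintegrable (fun l => f l * conjc (g l)).
Proof.
move=> /inL2P[mf fi] /inL2P[mg gi].
have [mr mi] := cmeasM mf (cmeas_conj mg).
have int := integrableD measurableT fi gi.
split; (apply: le_integrable int => //; first exact/measurable_EFinP);
  move=> p _; rewrite /= lee_fin [leRHS]ger0_norm ?addr_ge0 ?sqmod_ge0//;
  rewrite /sqmod !normc_sqE ?ReM ?ImM ReJ ImJ.
- case: (f _) => a b; case: (g _) => c d /=; rewrite ler_norml.
  have := sqr_ge0 (a - c); have := sqr_ge0 (b - d).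
  have := sqr_ge0 (a + c); have := sqr_ge0 (b + d).
  have := (sqr_ge0 a, sqr_ge0 b, sqr_ge0 c, sqr_ge0 d).
  by move=> [[[? ?] ?] ?] ? ? ? ?; apply/andP; split; nra.
- case: (f _) => a b; case: (g _) => c d /=; rewrite ler_norml.
  have := sqr_ge0 (a - d); have := sqr_ge0 (b - c).
  have := sqr_ge0 (a + d); have := sqr_ge0 (b + c).
  have := (sqr_ge0 a, sqr_ge0 b, sqr_ge0 c, sqr_ge0 d).
  by move=> [[[? ?] ?] ?] ? ? ? ?; apply/andP; split; nra.
Qed.

Lemma cinner_self f : inL2 f -> cinner f f = (sqnormL2 f)%:C.
Proof.
move=> Lf; rewrite cinnerE /cint; congr Complex.
  by apply: eq_Rintegral => p _; rewrite mulcJ.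
under eq_Rintegral do rewrite mulcJ /=.
by rewrite Rintegral_cst// mul0r.
Qed.

End complex_L2.

(** * Expansions along an orthogonal family *)

Section orthogonal_family.
Variable R : realType.
Local Notation C := R[i].
Implicit Types f g : C -> C.

Lemma conjcB (z w : C) : conjc (z - w) = conjc z - conjc w.
Proof. exact: rmorphB. Qed.
Lemma conjcM (z w : C) : conjc (z * w) = conjc z * conjc w.
Proof. exact: rmorphM. Qed.
Lemma conjc_sum (I : Type) (s : seq I) (F : I -> C) :
  conjc (\sum_(k <- s) F k) = \sum_(k <- s) conjc (F k).
Proof. exact: rmorph_sum. Qed.

Lemma real_mul_sqnormc (a : R) (z : C) :
  (a * normc z ^+ 2)%:C = a%:C * (z * conjc z).
Proof. by rewrite mulcJ rmorphM. Qed.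

Lemma cinnerC f g : inL2 f -> inL2 g -> cinner g f = conjc (cinner f g).
Proof.
move=> Lf Lg; rewrite !cinnerE -cint_conj; last exact: cintegrable_inner.
by congr cint; apply/funext => l; rewrite rmorphM /= conjcK mulrC.
Qed.

Lemma cinnerDl f g u : inL2 f -> inL2 g -> inL2 u ->
  cinner (fun l => f l + g l) u = cinner f u + cinner g u.
Proof.
move=> Lf Lg Lu; rewrite !cinnerE -cintD; try exact: cintegrable_inner.
by congr cint; apply/funext => l; rewrite mulrDl.
Qed.

Lemma cinnerZl z f g : inL2 f -> inL2 g ->
  cinner (fun l => z * f l) g = z * cinner f g.
Proof.
move=> Lf Lg; rewrite !cinnerE -cintZ; last exact: cintegrable_inner.
by congr cint; apply/funext => l; rewrite mulrA.
Qed.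

Lemma cinnerBl f g u : inL2 f -> inL2 g -> inL2 u ->
  cinner (fun l => f l - g l) u = cinner f u - cinner g u.
Proof.
move=> Lf Lg Lu; rewrite -[X in _ = _ + X]mulN1r -cinnerZl// -cinnerDl//.
  by congr (cinner _ u); apply/funext => l; rewrite mulN1r.
exact: inL2Z.
Qed.

Lemma cinner_suml (I : Type) (s : seq I) (h : I -> C -> C) (d : I -> C) g :
  (forall k, inL2 (h k)) -> inL2 g ->
  cinner (fun l => \sum_(k <- s) h k l * d k) g = \sum_(k <- s) d k * cinner (h k) g.
Proof.
move=> Lh Lg; elim: s => [|k s IH].
  under [X in cinner X _]eq_fun do rewrite big_nil.
  rewrite big_nil cinnerE -[RHS]cint0.
  by congr cint; apply/funext => l; rewrite mul0r.
under [X in cinner X _]eq_fun do rewrite big_cons mulrC.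
by rewrite cinnerDl ?cinnerZl ?IH ?big_cons//; [exact: inL2Z|exact: inL2_sum].
Qed.

Variables (I : choiceType) (h : I -> C -> C) (N : I -> R).
Hypothesis Lh : forall k, inL2 (h k).
Hypothesis h_orth : forall k l, k != l -> cinner (h k) (h l) = 0.
Hypothesis h_norm : forall k, cinner (h k) (h k) = (N k)%:C.
Hypothesis N_gt0 : forall k, 0 < N k.

Definition lincomb (A : {fset I}) (d : I -> C) (l : C) := \sum_(k <- A) h k l * d k.
Definition fcoef f k : C := cinner f (h k) / (N k)%:C.
Definition proj (A : {fset I}) f := lincomb A (fcoef f).

Lemma inL2_lincomb A d : inL2 (lincomb A d).
Proof. exact: inL2_sum. Qed.

Lemma NC_neq0 k : (N k)%:C != 0.
Proof. by rewrite eq_complex /= eqxx andbT gt_eqF. Qed.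

Lemma fcoefE f k : cinner f (h k) = (N k)%:C * fcoef f k.
Proof. by rewrite mulrC divfK// NC_neq0. Qed.

Lemma cinner_lincomb (A : {fset I}) d j :
  cinner (lincomb A d) (h j) = if j \in A then (N j)%:C * d j else 0.
Proof.
rewrite cinner_suml//; case: ifPn => jA.
  rewrite (big_fsetD1 j)//= h_norm mulrC big1_fset ?addr0//= => k.
  by rewrite !inE => /andP[kj _] _; rewrite h_orth ?mulr0.
rewrite big1_fset// => k kA _; rewrite h_orth ?mulr0//.
by apply: contraNneq jA => <-.
Qed.

(** The coefficients are abstract here, which keeps the integrals that define them
    out of the final ring identity. *)
Let pythagoras_coef f (A : {fset I}) c d : inL2 f ->
  (forall k, cinner f (h k) = (N k)%:C * c k) ->
  sqnormL2 (fun l => f l - lincomb A d l) =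
  sqnormL2 f - (\sum_(k <- A) N k * normc (c k) ^+ 2) +
  (\sum_(k <- A) N k * normc (d k - c k) ^+ 2).
Proof.
move=> Lf fc; have Lc := inL2_lincomb A d.
apply: (@complexI R); rewrite -cinner_self; last exact: inL2B.
rewrite cinnerBl//; last exact: inL2B.
rewrite [cinner f _]cinnerC//; last exact: inL2B.
rewrite [cinner (lincomb A d) _]cinnerC//; last exact: inL2B.
rewrite !cinnerBl// [cinner (lincomb A d) f]cinner_suml//.
rewrite [cinner f (lincomb A d)]cinnerC// [cinner (lincomb A d) f]cinner_suml//.
rewrite [cinner (lincomb A d) (lincomb A d)]cinner_suml//.
rewrite cinner_self// !conjcB conjc_real !conjc_sum !rmorphD !rmorphN !rmorph_sum.
rewrite -!addrA; congr (_ + _).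
rewrite !opprB -!sumrN -!big_split/=.
apply: eq_big_seq => k kA.
rewrite [cinner (h k) f]cinnerC// [cinner (h k) (lincomb _ _)]cinnerC//.
rewrite cinner_lincomb kA fc !real_mul_sqnormc !conjcM !conjcB !conjcK.
rewrite !conjc_real.
ring.
Qed.

(** Completing the square in each coefficient.  The last sum is the only term
    that depends on [d], so the Fourier coefficients give the best
    approximation; it also bounds every coefficient error by the distance,
    which makes the coefficients of an expansion unique. *)
Lemma pythagoras f (A : {fset I}) d : inL2 f ->
  sqnormL2 (fun l => f l - lincomb A d l) =
  sqnormL2 f - (\sum_(k <- A) N k * normc (fcoef f k) ^+ 2) +
  (\sum_(k <- A) N k * normc (d k - fcoef f k) ^+ 2).
Proof. by move=> Lf; apply: pythagoras_coef => // k; exact: fcoefE. Qed.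

Lemma bessel f (A : {fset I}) : inL2 f ->
  \sum_(k <- A) N k * normc (fcoef f k) ^+ 2 <= sqnormL2 f.
Proof.
move=> Lf; have := sqnormL2_ge0 (fun l => f l - proj A f l).
rewrite pythagoras// [X in _ + X]big1 ?addr0 ?subr_ge0// => k _.
by rewrite subrr normc0 expr0n mulr0.
Qed.

Lemma proj_best f (A : {fset I}) d : inL2 f ->
  sqnormL2 (fun l => f l - proj A f l) <= sqnormL2 (fun l => f l - lincomb A d l).
Proof.
move=> Lf; rewrite !pythagoras// lerD2l [leLHS]big1 => [|k _].
  by apply: sumr_ge0 => k _; rewrite mulr_ge0 ?sqr_ge0// ltW.
by rewrite subrr normc0 expr0n mulr0.
Qed.

Lemma proj_residual_le f (A : {fset I}) : inL2 f -> sqnormL2 (fun l => f l - proj A f l) <= sqnormL2 f.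
Proof.
move=> Lf; apply: le_trans (proj_best A (fun=> 0) Lf) _.
rewrite le_eqVlt; apply/orP; left; apply/eqP; congr sqnormL2; apply/funext => l.
by rewrite /lincomb big1 ?subr0// => k _; rewrite mulr0.
Qed.

Lemma coef_close f (A : {fset I}) d k : inL2 f -> k \in A ->
  N k * normc (d k - fcoef f k) ^+ 2 <= sqnormL2 (fun l => f l - lincomb A d l).
Proof.
move=> Lf kA; rewrite pythagoras// [X in _ <= _ + X](big_fsetD1 k kA)/=.
set S := (X in sqnormL2 f - X); have := bessel A Lf; rewrite -/S => SA.
rewrite addrCA lerDl addr_ge0 ?subr_ge0//.
by apply: sumr_ge0 => j _; rewrite mulr_ge0 ?sqr_ge0// ltW.
Qed.

(** The closed linear span, stated as convergence of the Fourier projections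
    along finite index sets: by [proj_best] this is the same as being a limit of
    finite combinations, and it is already the expansion to be proved. *)
Definition in_span f := inL2 f /\ forall e : R, 0 < e ->
  exists A0 : {fset I}, forall A : {fset I}, (A0 `<=` A)%fset ->
    sqnormL2 (fun l => f l - proj A f l) < e.

Lemma fcoefD f g k : inL2 f -> inL2 g ->
  fcoef (fun l => f l + g l) k = fcoef f k + fcoef g k.
Proof. by move=> Lf Lg; rewrite /fcoef cinnerDl// mulrDl. Qed.

Lemma fcoefZ z f k : inL2 f -> fcoef (fun l => z * f l) k = z * fcoef f k.
Proof. by move=> Lf; rewrite /fcoef cinnerZl// mulrA. Qed.

Lemma projD (A : {fset I}) f g l : inL2 f -> inL2 g ->
  proj A (fun l => f l + g l) l = proj A f l + proj A g l.
Proof.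
move=> Lf Lg; rewrite /proj /lincomb -big_split/=; apply: eq_bigr => k _.
by rewrite fcoefD// mulrDr.
Qed.

Lemma projZ (A : {fset I}) z f l : inL2 f -> proj A (fun l => z * f l) l = z * proj A f l.
Proof.
move=> Lf; rewrite /proj /lincomb mulr_sumr; apply: eq_bigr => k _.
by rewrite fcoefZ// mulrCA.
Qed.

Let quarters_lt (a b e : R) : a < e / 4 -> b < e / 4 -> 2 * a + 2 * b < e.
Proof. by move=> ae be; lra. Qed.

(** The projection residual of [f] splits into those of [f - g] and of [g]; the
    first is at most the norm of [f - g] by Bessel's inequality. *)
Lemma in_span_closed f : inL2 f ->
  (forall e : R, 0 < e -> exists2 g, in_span g & sqnormL2 (fun l => f l - g l) < e) ->
  in_span f.
Proof.
move=> Lf H; split=> // e e0.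
have e4 : 0 < e / 4 by rewrite divr_gt0.
have [g [Lg gs] fg] := H _ e4; have [A0 HA] := gs _ e4; exists A0 => A A0A.
pose u l := f l - g l; have Lu : inL2 u by exact: inL2B.
have fE : f = fun l => u l + g l by apply/funext => l; rewrite subrK.
have -> : (fun l => f l - proj A f l) =
    (fun l => (u l - proj A u l) + (g l - proj A g l)).
  apply/funext => l; rewrite [in proj A f]fE projD// {1}fE; ring.
apply: le_lt_trans (sqnormL2D_le _ _) _; try by apply/inL2B => //; exact: inL2_lincomb.
exact: quarters_lt (le_lt_trans (proj_residual_le A Lu) fg) (HA _ A0A).
Qed.

Lemma in_spanD f g : in_span f -> in_span g -> in_span (fun l => f l + g l).
Proof.
move=> [Lf fs] [Lg gs]; split=> [|e e0]; first exact: inL2D.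
have e4 : 0 < e / 4 by rewrite divr_gt0.
have [A1 H1] := fs _ e4; have [A2 H2] := gs _ e4.
exists (A1 `|` A2)%fset => A; rewrite fsubUset => /andP[/H1 h1 /H2 h2].
have -> : (fun l => f l + g l - proj A (fun l => f l + g l) l) =
    (fun l => (f l - proj A f l) + (g l - proj A g l)).
  by apply/funext => l; rewrite projD//; ring.
apply: le_lt_trans (sqnormL2D_le _ _) _; try by apply/inL2B => //; exact: inL2_lincomb.
exact: quarters_lt.
Qed.

Lemma in_spanZ z f : in_span f -> in_span (fun l => z * f l).
Proof.
move=> [Lf fs]; split=> [|e e0]; first exact: inL2Z.
have K0 : 0 < normc z ^+ 2 + 1 by rewrite ltr_wpDl ?sqr_ge0.
have [A0 H] := fs _ (divr_gt0 e0 K0); exists A0 => A /H h1.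
have -> : (fun l => z * f l - proj A (fun l => z * f l) l) =
    (fun l => z * (f l - proj A f l)).
  by apply/funext => l; rewrite projZ//; ring.
have Lr : inL2 (fun l => f l - proj A f l) by apply: inL2B => //; exact: inL2_lincomb.
apply: (@le_lt_trans _ _ ((normc z ^+ 2 + 1) * sqnormL2 (fun l => f l - proj A f l))).
  apply: sqnormL2_le_mul => //; [exact: ltW|exact: inL2Z|move=> l].
  by rewrite normcM exprMn ler_wpM2r ?sqr_ge0// lerDl.
by rewrite mulrC -ltr_pdivlMr.
Qed.

Lemma sqnormL20 : sqnormL2 (fun=> 0 : C) = 0.
Proof.
rewrite /sqnormL2 /sqmod; under eq_Rintegral do rewrite normc0 expr0n /=.
by rewrite Rintegral_cst// mul0r.
Qed.

Lemma in_span_h k : in_span (h k).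
Proof.
split=> // e e0; exists [fset k]%fset => A; rewrite fsub1set => kA.
have -> : (fun l => h k l - proj A (h k) l) = (fun=> 0); last by rewrite sqnormL20.
apply/funext => l; rewrite /proj /lincomb (big_fsetD1 k kA)/= big1_fset => [|j].
  by rewrite /fcoef h_norm divff ?NC_neq0// mulr1 addr0 subrr.
rewrite !inE => /andP[jk _] _.
by rewrite /fcoef h_orth ?mul0r ?mulr0// eq_sym.
Qed.

Lemma in_spanN f : in_span f -> in_span (fun l => - f l).
Proof.
move=> /(in_spanZ (-1)); rewrite (_ : (fun l => _) = fun l => - f l)//.
by apply/funext => l; rewrite mulN1r.
Qed.

Lemma in_spanB f g : in_span f -> in_span g -> in_span (fun l => f l - g l).
Proof. by move=> sf /in_spanN; exact: in_spanD. Qed.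

Lemma in_span0 : in_span (fun=> 0).
Proof.
split=> [|e e0]; first exact: inL2_0; exists fset0 => A _.
apply: le_lt_trans (proj_residual_le _ (inL2_0 R)) _.
by rewrite sqnormL20.
Qed.

Lemma in_span_sum (J : Type) (s : seq J) (g : J -> C -> C) :
  (forall j, in_span (g j)) -> in_span (fun l => \sum_(j <- s) g j l).
Proof.
move=> gs; elim: s => [|j s IH].
  have -> : (fun l => \sum_(j <- [::]) g j l) = fun=> 0; last exact: in_span0.
  by apply/funext => l; rewrite big_nil.
have -> : (fun l => \sum_(i <- j :: s) g i l) =
    fun l => g j l + \sum_(i <- s) g i l.
  by apply/funext => l; rewrite big_cons.
exact: (in_spanD (gs j) IH).
Qed.

Lemma in_span_cvg (fn : nat -> C -> C) f : inL2 f -> (forall n, in_span (fn n)) ->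
  sqnormL2 (fun l => f l - fn n l) @[n --> \oo] --> (0 : R) -> in_span f.
Proof.
move=> Lf sfn /cvgrPdist_lt H; apply: in_span_closed => // e e0.
have [n _ /(_ n (leqnn n))] := H e e0.
rewrite sub0r normrN ger0_norm ?sqnormL2_ge0// => ?.
by exists (fn n).
Qed.

End orthogonal_family.

(** * Gaussian integrals of monomials *)

Section gaussian_moments.
Variable R : realType.
Local Notation C := R[i].
Local Notation plane := (measurableTypeR R * measurableTypeR R)%type.

(** The square of [exp (|l| ^ 2 / 4)] is the integrable function of
    [integrable_exp_sqdist]. *)
Lemma inL2_growth (f : C -> C) (K : R) : cmeas f ->
  (forall l, normc (f l) <= K * expR (normc l ^+ 2 / 4)) -> inL2 f.
Proof.
move=> mf fK; apply/inL2P; split => //.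
have int := integrableZl measurableT (K ^+ 2) (@integrable_exp_sqdist R).
apply: le_integrable int => //; first by apply/measurable_EFinP; apply: measurable_sqmod.
move=> p _; rewrite /= lee_fin ger0_norm ?sqmod_ge0//.
apply: le_trans (ler_norm _); rewrite /sqmod.
have := fK (cpt p); rewrite -sqdistE => H.
have -> : expR (sqdist p / 2) = expR (sqdist p / 4) ^+ 2.
  by rewrite -expRM_natl; congr expR; field.
by rewrite -exprMn lerXn2r// nnegrE ?normc_ge0//; apply: le_trans H; exact: normc_ge0.
Qed.

Lemma normc_Re_le (z : C) : `|complex.Re z| <= normc z.
Proof.
case: z => a b; rewrite -sqrtr_sqr /normc ler_sqrt ?addr_ge0 ?sqr_ge0//=.
by rewrite lerDl sqr_ge0.
Qed.

Lemma normc_Im_le (z : C) : `|complex.Im z| <= normc z.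
Proof.
case: z => a b; rewrite -sqrtr_sqr /normc ler_sqrt ?addr_ge0 ?sqr_ge0//=.
by rewrite lerDr sqr_ge0.
Qed.

(** The coordinates are kept next to [l] and its conjugate so that the
    recursions below can trade [l = x + i y] for [x] and [y] one factor at a
    time. *)
Definition mono i j a b (l : C) : C :=
  (complex.Re l)%:C ^+ i * (complex.Im l)%:C ^+ j * l ^+ a * conjc l ^+ b.

Lemma cmeas_mono i j a b : cmeas (mono i j a b).
Proof.
have mid := cmeas_id R.
apply: cmeasM; last by apply: cmeasX; exact: cmeas_conj.
apply: cmeasM; last exact: cmeasX.
apply: cmeasM; apply: cmeasX; apply: cmeas_real.
  exact: measurable_fst.
exact: measurable_snd.
Qed.

Lemma mono_growth i j a b (c : R) : 0 < c -> exists2 K, 0 <= K &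
  forall l, normc (mono i j a b l) <= K * expR (c * normc l ^+ 2).
Proof.
move=> c0; have [K K0 HK] := norm_pow_le_expR (i + j + a + b) c0.
exists K => // l; apply: le_trans (HK _).
rewrite !normcM !normcX !normc_real normc_conjc (ger0_norm (normc_ge0 l)).
rewrite !exprD ler_wpM2r ?exprn_ge0 ?normc_ge0// ler_wpM2r ?exprn_ge0 ?normc_ge0//.
by apply: ler_pM => //; rewrite ?exprn_ge0 ?normr_ge0// lerXn2r ?nnegrE ?normr_ge0
  ?normc_ge0// ?normc_Re_le ?normc_Im_le.
Qed.

Lemma inL2_mono i j a b : inL2 (mono i j a b).
Proof.
have c0 : 0 < 4^-1 :> R by rewrite invr_gt0.
have [K K0 HK] := mono_growth i j a b c0.
apply: (@inL2_growth _ K); first exact: cmeas_mono.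
by move=> l; rewrite [_ / 4]mulrC; exact: HK.
Qed.

Lemma mono0 : mono 0 0 0 0 = fun=> 1.
Proof. by apply/funext => l; rewrite /mono !expr0 !mulr1. Qed.

Lemma inL2_1 : inL2 (fun=> 1 : C).
Proof. by rewrite -mono0; exact: inL2_mono. Qed.

Lemma inL2_cintegrable (f : C -> C) : inL2 f -> cintegrable f.
Proof.
move=> Lf; have := cintegrable_inner Lf inL2_1.
by congr cintegrable; apply/funext => l; rewrite conjc1 mulr1.
Qed.

Lemma cintegrable_mono i j a b : cintegrable (mono i j a b).
Proof. exact/inL2_cintegrable/inL2_mono. Qed.

Definition mono_int i j a b := cint (mono i j a b).

Lemma mono_int_z i j a b :
  mono_int i j a.+1 b = mono_int i.+1 j a b + 'i%C * mono_int i j.+1 a b.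
Proof.
rewrite /mono_int -cintZ; last exact: cintegrable_mono.
rewrite -cintD; [|exact: cintegrable_mono|exact/cintegrableZ/cintegrable_mono].
congr cint; apply/funext => l; rewrite /mono !exprS {3}[l]complexE; ring.
Qed.

Lemma conjc_complexE (l : C) :
  conjc l = (complex.Re l)%:C - 'i%C * (complex.Im l)%:C.
Proof. by case: l => x y; apply/eqP; rewrite eq_complex /=; apply/andP; split; apply/eqP; ring. Qed.

Lemma mono_int_zbar i j a b :
  mono_int i j a b.+1 = mono_int i.+1 j a b + (- 'i%C) * mono_int i j.+1 a b.
Proof.
rewrite /mono_int -cintZ; last exact: cintegrable_mono.
rewrite -cintD; [|exact: cintegrable_mono|exact/cintegrableZ/cintegrable_mono].
congr cint; apply/funext => l; rewrite /mono !exprS {1}conjc_complexE; ring.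
Qed.

Lemma mono_int_xy i j : mono_int i j 0 0 = (moment R i)%:C * (moment R j)%:C.
Proof.
rewrite -rmorphM /= -integral_gaussC_monomial /mono_int /cint.
have E (p : plane) : mono i j 0 0 (cpt p) = (p.1 ^+ i * p.2 ^+ j)%:C.
  by rewrite /mono !expr0 !mulr1 rmorphM /= !rmorphXn.
congr Complex; under eq_Rintegral do rewrite E //=.
  by [].
by rewrite Rintegral_cst// mul0r.
Qed.

End gaussian_moments.

(** Integration by parts for a Gaussian, on monomials.  Here [F i j a b] stands
    for the expectation of [x ^ i * y ^ j * z ^ a * zbar ^ b]; the hypotheses are
    the linear relations between these numbers and the moments of [x] and [y]. *)
Section stein.
Variable R : realType.
Local Notation C := R[i].
Variables (F : nat -> nat -> nat -> nat -> C) (m : nat -> C).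
Hypothesis Fz : forall i j a b, F i j a.+1 b = F i.+1 j a b + 'i%C * F i j.+1 a b.
Hypothesis Fzbar : forall i j a b,
  F i j a b.+1 = F i.+1 j a b + (- 'i%C) * F i j.+1 a b.
Hypothesis Fxy : forall i j, F i j 0 0 = m i * m j.
Hypothesis m_rec : forall k, 2 * m k.+1 = k%:R * m k.-1.

(** This is [2 E (x P) = E (dP / dx)] with [dz / dx = dzbar / dx = 1].  Without
    [z] and [zbar] it is the moment recursion; a factor [z] or [zbar] is then
    removed by expanding it into [x] and [y]. *)
Lemma stein_x a b i j : 2 * F i.+1 j a b =
  i%:R * F i.-1 j a b + a%:R * F i j a.-1 b + b%:R * F i j a b.-1.
Proof.
elim: a i j => [|a IHa] i j.
  elim: b i j => [|b IHb] i j.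
    by rewrite !mul0r !addr0 !Fxy mulrA m_rec mulrA.
  rewrite Fzbar mulrDr IHb mulrCA IHb /=.
  rewrite mul0r mul0r !addr0.
  have -> : i%:R * F i.-1 j 0 b.+1 =
      i%:R * (F i j 0 b - 'i%C * F i.-1 j.+1 0 b).
    by case: i => [|i]; rewrite ?mul0r// Fzbar /= mulNr.
  have -> : b%:R * F i.+1 j 0 b.-1 =
      b%:R * (F i j 0 b + 'i%C * F i j.+1 0 b.-1).
    by case: b {IHb} => [|b]; rewrite ?mul0r// Fzbar /=; ring.
  rewrite -!natr1; ring.
rewrite Fz mulrDr IHa mulrCA IHa /=.
have -> : i%:R * F i.-1 j a.+1 b =
    i%:R * (F i j a b + 'i%C * F i.-1 j.+1 a b).
  by case: i => [|i]; rewrite ?mul0r// Fz.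
have -> : a%:R * F i.+1 j a.-1 b =
    a%:R * (F i j a b - 'i%C * F i j.+1 a.-1 b).
  by case: a {IHa} => [|a]; rewrite ?mul0r// Fz /=; ring.
rewrite Fz -!natr1; ring.
Qed.

(** The analogue in [y], where [dz / dy = i] and [dzbar / dy = - i]. *)
Lemma stein_y a b i j : 2 * F i j.+1 a b =
  j%:R * F i j.-1 a b + 'i%C * a%:R * F i j a.-1 b - 'i%C * b%:R * F i j a b.-1.
Proof.
have ii : 'i%C * 'i%C = -1 :> C by exact: sqri.
elim: a i j => [|a IHa] i j.
  elim: b i j => [|b IHb] i j.
    by rewrite !mulr0 !mul0r subr0 addr0 !Fxy mulrCA m_rec mulrCA.
  rewrite Fzbar mulrDr IHb mulrCA IHb /=.
  rewrite !mulr0 !mul0r !addr0.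
  have -> : j%:R * F i j.-1 0 b.+1 =
      j%:R * (F i.+1 j.-1 0 b - 'i%C * F i j 0 b).
    by case: j => [|j]; rewrite ?mul0r// Fzbar /= mulNr.
  rewrite -[_ * _ * F i.+1 j 0 b.-1]mulrA.
  have -> : b%:R * F i.+1 j 0 b.-1 =
      b%:R * (F i j 0 b + 'i%C * F i j.+1 0 b.-1).
    by case: b {IHb} => [|b]; rewrite ?mul0r// Fzbar /=; ring.
  rewrite -!natr1; ring: ii.
rewrite Fz mulrDr IHa mulrCA IHa /=.
have -> : j%:R * F i j.-1 a.+1 b =
    j%:R * (F i.+1 j.-1 a b + 'i%C * F i j a b).
  by case: j => [|j]; rewrite ?mul0r// Fz.
rewrite -[_ * _ * F i.+1 j a.-1 b]mulrA.
have -> : a%:R * F i.+1 j a.-1 b =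
    a%:R * (F i j a b - 'i%C * F i j.+1 a.-1 b).
  by case: a {IHa} => [|a]; rewrite ?mul0r// Fz /=; ring.
rewrite Fz -!natr1; ring: ii.
Qed.

(** Adding the two previous identities, the derivatives in [z] cancel and
    [E (z P) = E (dP / dzbar)] remains. *)
Lemma stein_z a b : F 0 0 a.+1 b = b%:R * F 0 0 a b.-1.
Proof.
have ii : 'i%C * 'i%C = -1 :> C by exact: sqri.
have two : 2 != 0 :> C by rewrite pnatr_eq0.
apply: (mulfI two); rewrite Fz mulrDr stein_x mulrCA stein_y /=.
rewrite !mul0r !add0r mulrBr !mulrA ii; ring.
Qed.

End stein.

(** * Orthogonality of the complex Hermite polynomials *)

Section hermite.
Variable R : realType.
Local Notation C := R[i].

Lemma moment_recC k : 2 * (moment R k.+1)%:C = k%:R * (moment R k.-1)%:C :> C.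
Proof.
have := congr1 (real_complex R) (moment_rec R k).
by rewrite !rmorphM /= !rmorph_nat.
Qed.

Definition zmom a b : C := mono_int R 0 0 a b.

Lemma zmom_rec a b : zmom a.+1 b = b%:R * zmom a b.-1.
Proof.
apply: (@stein_z R (mono_int R) (fun k => (moment R k)%:C)).
- exact: mono_int_z.
- exact: mono_int_zbar.
- exact: mono_int_xy.
- exact: moment_recC.
Qed.

Definition hcoef m n k : C := (-1) ^+ k * (k`! * 'C(m, k) * 'C(n, k))%:R.

(** The sum runs up to [m] instead of [minn m n]: the added terms contain a
    vanishing binomial, and the range no longer depends on [n], so that
    [hermite m n] and [hermite m n.-1] can be compared term by term. *)
Definition hermite m n (l : C) : C :=
  \sum_(k < m.+1) hcoef m n k * (l ^+ (m - k) * conjc l ^+ (n - k)).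

Lemma hermiteE m n l : hermite m n l =
  \sum_(k < (minn m n).+1)
    (-1) ^+ k * (k`! * 'C(m, k) * 'C(n, k))%:R * l ^+ (m - k) * conjc l ^+ (n - k).
Proof.
rewrite (big_ord_widen m.+1 (fun k => (-1) ^+ k *
  (k`! * 'C(m, k) * 'C(n, k))%:R * l ^+ (m - k) * conjc l ^+ (n - k))); last first.
  by rewrite ltnS geq_minl.
rewrite [RHS]big_mkcond; apply: eq_bigr => k _; rewrite ltnS leq_min -[(k <= m)%N]ltnS ltn_ord /=.
rewrite /hcoef; case: leqP => kn; first by rewrite !mulrA.
by rewrite [X in (_ * X)%N]bin_small// muln0 mulr0 mul0r.
Qed.

Lemma hermite_conj m n l : conjc (hermite m n l) = hermite n m l.
Proof.
rewrite !hermiteE conjc_sum minnC; apply: eq_bigr => k _.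
have cX z p : conjc (z ^+ p) = conjc z ^+ p :> C by exact: rmorphXn.
have cN1 : conjc (-1) = -1 :> C by exact: rmorphN1.
rewrite !conjcM !cX conjcK conjc_nat cN1.
by rewrite mulrAC -!mulnA [('C(m, k) * _)%N]mulnC.
Qed.

Lemma hermite00 l : hermite 0 0 l = 1.
Proof. by rewrite hermiteE big_ord1 !expr0 !mulr1. Qed.

Lemma hcoef_pred m n k : n%:R * hcoef m n.-1 k = hcoef m n k * (n - k)%:R.
Proof.
rewrite /hcoef mulrCA -!mulrA; congr (_ * _); rewrite -!natrM; congr (_%:R).
by rewrite mulnCA mul_bin_down [in RHS]mulnC mulnCA.
Qed.

(** The right-hand side is the derivative of [hermite m n] in the conjugate
    variable, taken formally on monomials. *)
Lemma hermite_dbar m n l : n%:R * hermite m n.-1 l =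
  \sum_(k < m.+1) hcoef m n k * (n - k)%:R * (l ^+ (m - k) * conjc l ^+ (n - k).-1).
Proof.
rewrite /hermite mulr_sumr; apply: eq_bigr => k _.
by rewrite mulrA hcoef_pred -subn1 subnAC subn1.
Qed.

(** Pascal's rule in [m], and absorption of [k.+1] into the binomial in [n]. *)
Lemma hcoef_rec m n k : hcoef m.+1 n k.+1 =
  hcoef m n k.+1 - n%:R * hcoef m n.-1 k.
Proof.
rewrite /hcoef binS mulnDr mulnDl natrD mulrDr; congr (_ + _).
rewrite exprS mulN1r mulNr mulrCA -[in RHS]natrM; congr (- (_ * _%:R)).
by rewrite factS [RHS]mulnCA mul_bin_diag; ring.
Qed.

(** The [m]-raising operator [z - d/dzbar] applied to [hermite m n]. *)
Lemma hermite_recl m n l :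
  hermite m.+1 n l = l * hermite m n l - n%:R * hermite m n.-1 l.
Proof.
rewrite [in LHS]/hermite big_ord_recl [l * _]mulr_sumr.
under eq_bigr do rewrite hcoef_rec mulrBl.
rewrite sumrB addrA; congr (_ - _); last first.
  rewrite /hermite mulr_sumr; apply: eq_bigr => k _.
  by rewrite /= /bump /= add1n subSS mulrA; congr (_ * (_ * _ ^+ _)); lia.
rewrite big_ord_recr /= [X in _ + (_ + X)](_ : _ = 0) ?addr0; last first.
  by rewrite /hcoef bin_small// muln0 mul0n mulr0 mul0r.
rewrite [RHS]big_ord_recl; congr (_ + _).
  rewrite /hcoef !bin0 !subn0 !exprS; ring.
apply: eq_bigr => k _; rewrite /= /bump /= add1n subSS.
have -> : (m - k = (m - k.+1).+1)%N by have := ltn_ord k; lia.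
rewrite exprS; ring.
Qed.

Lemma cint_mul_sums M N (c d : nat -> C) (p q r s : nat -> nat) :
  cint (fun l => (\sum_(k < M) c k * (l ^+ p k * conjc l ^+ q k)) *
                 (\sum_(j < N) d j * (l ^+ r j * conjc l ^+ s j))) =
  \sum_(k < M) \sum_(j < N) c k * d j * zmom (p k + r j) (q k + s j).
Proof.
have i1 (k j : nat) : cintegrable (fun l => c k * d j * mono 0 0 (p k + r j) (q k + s j) l).
  by apply: cintegrableZ; exact: cintegrable_mono.
have i2 (k : nat) : cintegrable (fun l =>
    \sum_(j < N) c k * d j * mono 0 0 (p k + r j) (q k + s j) l).
  by apply: cintegrable_sum => j; exact: i1.
transitivity (cint (fun l => \sum_(k < M) \sum_(j < N)
    c k * d j * mono 0 0 (p k + r j) (q k + s j) l)).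
  congr cint; apply/funext => l; rewrite mulr_suml; apply: eq_bigr => k _.
  rewrite mulr_sumr; apply: eq_bigr => j _.
  by rewrite /mono !expr0 !mul1r !exprD; ring.
rewrite cint_sum => [|k]; last exact: i2.
apply: eq_bigr => k _; rewrite cint_sum => [|j]; last exact: i1.
by apply: eq_bigr => j _; rewrite cintZ//; exact: cintegrable_mono.
Qed.

(** Bilinear rather than sesquilinear: conjugation exchanges the two indices of
    a Hermite polynomial, and in this form the recursions involve no conjugates. *)
Definition hpair m n a b : C := cint (fun l => hermite m n l * hermite a b l).

Lemma inL2_monomial_sum M (c : nat -> C) (p q : nat -> nat) :
  inL2 (fun l : C => \sum_(k < M) c k * (l ^+ p k * conjc l ^+ q k)).
Proof.
have := @inL2_sum R 'I_M (index_enum 'I_M)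
  (fun k => mono 0 0 (p k) (q k)) (fun k => c k) (fun k => inL2_mono _ _ _ _ _).
congr inL2; apply/funext => l; apply: eq_bigr => k _.
by rewrite /mono !expr0 !mul1r mulrC.
Qed.

Lemma inL2_hermite m n : inL2 (hermite m n).
Proof. exact: (inL2_monomial_sum _ (hcoef m n) (subn m) (subn n)). Qed.

Lemma cintegrable_hermite2 m n a b :
  cintegrable (fun l => hermite m n l * hermite a b l).
Proof.
have := cintegrable_inner (inL2_hermite m n) (inL2_hermite b a).
by congr cintegrable; apply/funext => l; rewrite hermite_conj.
Qed.

(** Integration by parts, [E (z P Q) = E (dP/dzbar Q) + E (P dQ/dzbar)]. *)
Lemma cint_z_hermite2 m n a b :
  cint (fun l => l * hermite m n l * hermite a b l) =
  n%:R * hpair m n.-1 a b + b%:R * hpair m n a b.-1.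
Proof.
rewrite /hpair -!cintZ; try exact: cintegrable_hermite2.
have E1 : (fun l => n%:R * (hermite m n.-1 l * hermite a b l)) =
   (fun l => (\sum_(k < m.+1) (hcoef m n k * (n - k)%:R) *
       (l ^+ (m - k) * conjc l ^+ (n - k).-1)) *
     (\sum_(j < a.+1) hcoef a b j * (l ^+ (a - j) * conjc l ^+ (b - j)))).
  by apply/funext => l; rewrite mulrA hermite_dbar.
have E2 : (fun l => b%:R * (hermite m n l * hermite a b.-1 l)) =
   (fun l => (\sum_(k < m.+1) hcoef m n k * (l ^+ (m - k) * conjc l ^+ (n - k))) *
     (\sum_(j < a.+1) (hcoef a b j * (b - j)%:R) *
       (l ^+ (a - j) * conjc l ^+ (b - j).-1))).
  by apply/funext => l; rewrite mulrCA hermite_dbar.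
have E0 : (fun l => l * hermite m n l * hermite a b l) =
   (fun l => (\sum_(k < m.+1) hcoef m n k * (l ^+ (m - k).+1 * conjc l ^+ (n - k))) *
     (\sum_(j < a.+1) hcoef a b j * (l ^+ (a - j) * conjc l ^+ (b - j)))).
  apply/funext => l; congr (_ * _); rewrite mulr_sumr; apply: eq_bigr => k _.
  by rewrite exprS; ring.
rewrite E0 E1 E2.
rewrite (cint_mul_sums _ _ (hcoef m n) (hcoef a b) (fun k => (m - k).+1)%N
  (subn n) (subn a) (subn b)).
rewrite (cint_mul_sums _ _ (fun k => hcoef m n k * (n - k)%:R) (hcoef a b) (subn m)
  (fun k => (n - k).-1)%N (subn a) (subn b)).
rewrite (cint_mul_sums _ _ (hcoef m n) (fun j => hcoef a b j * (b - j)%:R) (subn m)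
  (subn n) (subn a) (fun j => (b - j).-1)%N).
rewrite -big_split; apply: eq_bigr => k _ /=.
rewrite -big_split; apply: eq_bigr => j _ /=.
rewrite addSn zmom_rec natrD.
(* A truncated predecessor of 0 only occurs multiplied by 0. *)
case: (n - k)%N => [|u]; case: (b - j)%N => [|v] /=; rewrite ?addn0 ?addnS ?addSn /=; ring.
Qed.

(** The raising operator and integration by parts combine: the term that
    differentiates [hermite m n] is removed by the recursion, so one index on
    the left is traded for one on the right. *)
Lemma hpair_recl m n a b : hpair m.+1 n a b = b%:R * hpair m n a b.-1.
Proof.
rewrite {1}/hpair.
have -> : (fun l => hermite m.+1 n l * hermite a b l) = (fun l =>
    l * hermite m n l * hermite a b l + (- n%:R) * (hermite m n.-1 l * hermite a b l)).
  by apply/funext => l; rewrite hermite_recl; ring.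
rewrite cintD; last first.
- by apply: cintegrableZ; exact: cintegrable_hermite2.
- have -> : (fun l => l * hermite m n l * hermite a b l) =
     (fun l => hermite m.+1 n l * hermite a b l +
       n%:R * (hermite m n.-1 l * hermite a b l)).
    by apply/funext => l; rewrite hermite_recl; ring.
  apply: cintegrableD; first exact: cintegrable_hermite2.
  by apply: cintegrableZ; exact: cintegrable_hermite2.
rewrite cint_z_hermite2 cintZ; last exact: cintegrable_hermite2.
by rewrite -/(hpair _ _ _ _); ring.
Qed.

Lemma hpair_conj m n a b : hpair n m b a = conjc (hpair m n a b).
Proof.
rewrite /hpair -cint_conj; last exact: cintegrable_hermite2.
by congr cint; apply/funext => l; rewrite conjcM !hermite_conj.
Qed.

Lemma hpair_recr m n a b : hpair m n.+1 a b = a%:R * hpair m n a.-1 b.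
Proof. by rewrite hpair_conj hpair_recl conjcM conjc_nat -hpair_conj. Qed.

Lemma hpairC m n a b : hpair m n a b = hpair a b m n.
Proof. by congr cint; apply/funext => l; rewrite mulrC. Qed.

(** Trading indices one by one ends with the total mass of the measure when the
    indices match, and with a factor 0 otherwise. *)
Lemma hpairE m n a b :
  hpair m n a b = if (m == b) && (n == a) then (m`! * n`!)%:R else 0.
Proof.
elim: m b => [|m IH] b.
  elim: n a => [|n IH] a.
    case: a => [|a]; last by rewrite hpairC hpair_recl mul0r andbF.
    case: b => [|b]; last by rewrite hpairC hpair_recr mul0r.
    transitivity (mono_int R 0 0 0 0); last by rewrite mono_int_xy moment0 mulr1.
    by congr cint; apply/funext => l; rewrite mono0 !hermite00 mulr1.
  rewrite hpair_recr; case: a => [|a]; first by rewrite mul0r andbF.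
  by rewrite IH eqSS /=; case: ifP => [/andP[_ /eqP <-]|_]; rewrite ?mulr0// -natrM mulnCA factS.
rewrite hpair_recl; case: b => [|b]; first by rewrite mul0r.
by rewrite IH eqSS /=; case: ifP => [/andP[/eqP <- _]|_]; rewrite ?mulr0// -natrM mulnA factS.
Qed.

Lemma cinner_hermite m n a b : cinner (hermite m n) (hermite a b) =
  if (m == a) && (n == b) then (m`! * n`!)%:R else 0.
Proof.
rewrite -hpairE /hpair cinnerE; congr cint.
by apply/funext => l; rewrite hermite_conj.
Qed.

End hermite.

(** * Dominated convergence in the mean *)

Section L2_dominated.
Variable R : realType.
Local Notation C := R[i].
Local Notation plane := (measurableTypeR R * measurableTypeR R)%type.

(** Apply dominated convergence to the square modulus of the difference, bounded
    by that of [2 g]. *)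
Lemma sqnormL2_dominated (fn : nat -> C -> C) (f g : C -> C) :
  (forall n, cmeas (fn n)) -> cmeas f -> inL2 g ->
  (forall n l, normc (fn n l) <= normc (g l)) ->
  (forall l, normc (f l) <= normc (g l)) ->
  (forall l, normc (f l - fn n l) @[n --> \oo] --> (0 : R)) ->
  sqnormL2 (fun l => f l - fn n l) @[n --> \oo] --> (0 : R).
Proof.
move=> mfn mf Lg fng fg fnf.
have Lfn n : inL2 (fn n) by apply: inL2_le Lg (fng n).
have Lf : inL2 f by apply: inL2_le Lg fg.
have Lr n : inL2 (fun l => f l - fn n l) by exact: inL2B.
pose r n (p : plane) : \bar R := (sqmod (fun l => f l - fn n l) p)%:E.
have mr n : measurable_fun setT (r n).
  by have /inL2P[_ /measurable_int] := Lr n.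
have r0 : {ae gaussC, forall p, setT p -> r ^~ p @ \oo --> (cst 0%E : plane -> \bar R) p}.
  apply/nearW => p _; apply: cvg_EFin; first exact: nearW.
  have := cvgM (fnf (cpt p)) (fnf (cpt p)) => /(_ _); rewrite mulr0 => H.
  exact: H.
pose g2 l := (2%:C : C) * g l.
have /inL2P[_ ig] : inL2 g2 by exact: inL2Z.
have rg : {ae gaussC, forall p n, setT p ->
    (`|r n p| <= (EFin \o sqmod g2) p)%E}.
  apply/nearW => p n _; rewrite /r /= lee_fin ger0_norm ?sqmod_ge0// /sqmod.
  rewrite lerXn2r ?nnegrE ?normc_ge0// normcM normc_real ger0_norm//.
  apply: le_trans (le_normcD _ _) _; rewrite normcN mulr_natl mulr2n.
  exact: lerD.
have [_ _] := @dominated_convergence _ _ R gaussC setT measurableT r (cst 0%E)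
  _ mr (measurable_cst _) r0 ig rg.
rewrite integral0 => /fine_cvgP[_].
by apply: cvg_trans; apply: near_eq_cvg; apply/nearW => n.
Qed.

Lemma exp_series_le (x : R) n : `|series (exp_coeff x) n| <= expR `|x|.
Proof.
have -> : expR `|x| = limn (series (exp_coeff `|x|)) by [].
apply: (@le_trans _ _ (series (exp_coeff `|x|) n)).
  rewrite -normed_series_exp_coeff; exact: ler_norm_sum.
apply: nondecreasing_cvgn_le; last exact: is_cvg_series_exp_coeff.
apply/nondecreasing_seqP => k; rewrite seriesSr lerDl.
exact: exp_coeff_ge0.
Qed.

Lemma exp_series_cvg (x : R) : series (exp_coeff x) n @[n --> \oo] --> expR x.
Proof. exact: is_cvg_series_exp_coeff. Qed.

Lemma cvg_real_mul_normc (u : nat -> R) (v : R) (z : C) :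
  u n @[n --> \oo] --> v -> normc (v%:C * z - (u n)%:C * z) @[n --> \oo] --> (0 : R).
Proof.
move=> uv; rewrite (_ : (fun n => _) = fun n => `|v - u n| * normc z).
  rewrite -(mul0r (normc z)); apply: cvgMr_tmp.
  by rewrite -(normr0 R) -(subrr v); apply: cvg_norm; apply: cvgB uv; exact: cvg_cst.
apply/funext => n.
by rewrite -mulrBl -rmorphB normcM normc_real.
Qed.

End L2_dominated.

(** * Bounded multipliers of the closed span *)

Section completeness.
Variable R : realType.
Local Notation C := R[i].
Local Notation plane := (measurableTypeR R * measurableTypeR R)%type.

Definition hfam (k : nat * nat) : C -> C := hermite k.1 k.2.
Definition hsqnorm (k : nat * nat) : R := (k.1`! * k.2`!)%:R.

Lemma inL2_hfam k : inL2 (hfam k). Proof. exact: inL2_hermite. Qed.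

Lemma hfam_orth k l : k != l -> cinner (hfam k) (hfam l) = 0.
Proof.
by case: k l => [m n] [a b]; rewrite xpair_eqE cinner_hermite => /negPf ->.
Qed.

Lemma hfam_norm k : cinner (hfam k) (hfam k) = (hsqnorm k)%:C.
Proof. by rewrite cinner_hermite !eqxx /hsqnorm /= rmorph_nat. Qed.

Lemma hsqnorm_gt0 k : 0 < hsqnorm k.
Proof. by rewrite ltr0n muln_gt0 !fact_gt0. Qed.

Definition hspan : (C -> C) -> Prop := in_span hfam hsqnorm.

Lemma hspan_L2 f : hspan f -> inL2 f. Proof. by case. Qed.

Lemma hspanD f g : hspan f -> hspan g -> hspan (fun l => f l + g l).
Proof. exact: (in_spanD inL2_hfam). Qed.

Lemma hspanZ z f : hspan f -> hspan (fun l => z * f l).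
Proof. exact: (in_spanZ inL2_hfam). Qed.

Lemma hspanB f g : hspan f -> hspan g -> hspan (fun l => f l - g l).
Proof. exact: (in_spanB inL2_hfam). Qed.

Lemma hspan_sum (J : Type) (s : seq J) (g : J -> C -> C) :
  (forall j, hspan (g j)) -> hspan (fun l => \sum_(j <- s) g j l).
Proof.
exact: (in_span_sum inL2_hfam hfam_orth hfam_norm hsqnorm_gt0).
Qed.

Lemma hspan_hfam k : hspan (hfam k).
Proof. exact: (in_span_h inL2_hfam hfam_orth hfam_norm hsqnorm_gt0). Qed.

Lemma hspan_closed f : inL2 f ->
  (forall e : R, 0 < e -> exists2 g, hspan g & sqnormL2 (fun l => f l - g l) < e) -> hspan f.
Proof. exact: (in_span_closed inL2_hfam hfam_orth hfam_norm hsqnorm_gt0). Qed.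

Lemma hspan_dominated (fn : nat -> C -> C) (f g : C -> C) :
  (forall n, hspan (fn n)) -> cmeas f -> inL2 g ->
  (forall n l, normc (fn n l) <= normc (g l)) ->
  (forall l, normc (f l) <= normc (g l)) ->
  (forall l, normc (f l - fn n l) @[n --> \oo] --> (0 : R)) ->
  hspan f.
Proof.
move=> Vfn mf Lg fng fg fnf; have Lf : inL2 f by apply: inL2_le Lg fg.
apply: (in_span_cvg inL2_hfam hfam_orth hfam_norm hsqnorm_gt0 Lf Vfn).
apply: (sqnormL2_dominated _ mf Lg fng fg fnf) => n.
by have /hspan_L2/inL2P[] := Vfn n.
Qed.

Definition emon a b (l : C) : C := l ^+ a * conjc l ^+ b.

Lemma emonE a b : emon a b = mono 0 0 a b.
Proof. by apply/funext => l; rewrite /mono !expr0 !mul1r. Qed.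

Lemma inL2_emon a b : inL2 (emon a b).
Proof. by rewrite emonE; exact: inL2_mono. Qed.

Lemma hermite_recr m n (l : C) :
  hermite m n.+1 l = conjc l * hermite m n l - m%:R * hermite m.-1 n l.
Proof.
by rewrite -hermite_conj hermite_recl conjcB !conjcM conjc_nat !hermite_conj.
Qed.

(** Each raising recursion, read backwards, writes a multiplication by [z] or its
    conjugate in terms of two Hermite polynomials. *)
Lemma hspan_emon a b : hspan (emon a b).
Proof.
suff H m n : hspan (fun l => emon a b l * hermite m n l).
  by have := H 0%N 0%N; congr hspan; apply/funext => l; rewrite hermite00 mulr1.
elim: a m n => [|a IHa] m n.
  elim: b m n => [|b IHb] m n.
    have := hspan_hfam (m, n); congr hspan; apply/funext => l.
    by rewrite /emon !expr0 !mul1r.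
  have := hspanD (IHb m n.+1) (hspanZ m%:R (IHb m.-1 n)); congr hspan; apply/funext => l.
  by rewrite hermite_recr /emon exprS; ring.
have := hspanD (IHa m.+1 n) (hspanZ n%:R (IHa m n.-1)); congr hspan; apply/funext => l.
by rewrite hermite_recl /emon exprS; ring.
Qed.

(** Asking the product with monomials, rather than with the whole span, to stay
    in the closed span makes the property checkable on Taylor polynomials;
    boundedness extends it to the whole span in [multiplier_hspan]. *)
Definition multiplier (u : C -> R) :=
  [/\ measurable_fun setT (fun p : plane => u (cpt p)),
      exists B, forall l, `|u l| <= B &
      forall a b, hspan (fun l => (u l)%:C * emon a b l)].

(** Multiplication by a bounded function is continuous in the mean, so the property
    passes from monomials to Hermite polynomials, to their combinations and to
    limits of these. *)
Lemma multiplier_hspan u f : multiplier u -> hspan f -> hspan (fun l => (u l)%:C * f l).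
Proof.
move=> [mu [B uB] uV] [Lf fs].
have B0 : 0 <= B by apply: le_trans (uB 0).
have uL g : inL2 g -> inL2 (fun l => (u l)%:C * g l).
  move=> Lg; apply: inL2_le (inL2Z B%:C Lg) _.
    by apply: cmeasM; [exact: cmeas_real|case/inL2P: Lg].
  move=> l; rewrite !normcM !normc_real ler_wpM2r ?normc_ge0//.
  by rewrite (ger0_norm B0).
apply: hspan_closed; first exact: uL.
move=> e e0; have K0 : 0 < B ^+ 2 + 1 by rewrite ltr_wpDl ?sqr_ge0.
have [A0 /(_ A0 (fsubset_refl _)) H] := fs _ (divr_gt0 e0 K0).
exists (fun l => (u l)%:C * proj hfam hsqnorm A0 f l).
  rewrite /proj /lincomb.
  have : hspan (fun l => \sum_(k <- A0) (fcoef hfam hsqnorm f k * ((u l)%:C * hfam k l))).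
    apply: hspan_sum => k; apply: hspanZ.
    have : hspan (fun l => \sum_(j < k.1.+1) hcoef R k.1 k.2 j *
        ((u l)%:C * emon (k.1 - j) (k.2 - j) l)).
      by apply: hspan_sum => j; apply: hspanZ; exact: uV.
    congr hspan; apply/funext => l; rewrite /hfam /hermite mulr_sumr.
    by apply: eq_bigr => j _; rewrite /emon; ring.
  congr hspan; apply/funext => l; rewrite mulr_sumr.
  by apply: eq_bigr => k _; ring.
have Lp : inL2 (fun l => f l - proj hfam hsqnorm A0 f l).
  by apply: inL2B => //; exact: (inL2_lincomb inL2_hfam).
have -> : (fun l => (u l)%:C * f l - (u l)%:C * proj hfam hsqnorm A0 f l) =
    (fun l => (u l)%:C * (f l - proj hfam hsqnorm A0 f l)).
  by apply/funext => l; rewrite mulrBr.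
apply: (@le_lt_trans _ _ ((B ^+ 2 + 1) * sqnormL2 (fun l => f l - proj hfam hsqnorm A0 f l))).
  apply: sqnormL2_le_mul => //; [exact: ltW|exact: uL|move=> l].
  rewrite normcM exprMn ler_wpM2r ?sqr_ge0// normc_real.
  by apply: (@le_trans _ _ (B ^+ 2)); rewrite ?lerDl// lerXn2r ?nnegrE.
by rewrite mulrC -ltr_pdivlMr.
Qed.

Lemma multiplier_cst c : multiplier (fun=> c).
Proof.
split; [exact: measurable_cst|by exists `|c| |move=> a b].
by apply: hspanZ; exact: hspan_emon.
Qed.

Lemma multiplierD u v : multiplier u -> multiplier v -> multiplier (fun l => u l + v l).
Proof.
move=> [mu [B uB] uV] [mv [B' vB] vV]; split; first exact: measurable_funD.
  by exists (B + B') => l; apply: le_trans (ler_normD _ _) _; exact: lerD.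
move=> a b; have := hspanD (uV a b) (vV a b); congr hspan; apply/funext => l.
by rewrite rmorphD mulrDl.
Qed.

(** The products of bounded multipliers are where [multiplier_hspan] is needed: the
    second factor sends a monomial into the closed span only. *)
Lemma multiplierM u v : multiplier u -> multiplier v -> multiplier (fun l => u l * v l).
Proof.
move=> Mu [mv [B' vB] vV]; have [mu [B uB] uV] := Mu.
split; first exact: measurable_funM.
  by exists (B * B') => l; rewrite normrM; exact: ler_pM.
move=> a b; have := multiplier_hspan Mu (vV a b); congr hspan; apply/funext => l.
by rewrite rmorphM mulrA.
Qed.

Lemma multiplierZ c u : multiplier u -> multiplier (fun l => c * u l).
Proof. exact/multiplierM/multiplier_cst. Qed.

Lemma multiplierX u n : multiplier u -> multiplier (fun l => u l ^+ n).
Proof.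
move=> Mu; elim: n => [|n IH]; first exact: multiplier_cst.
have -> : (fun l => u l ^+ n.+1) = (fun l => u l * u l ^+ n).
  by apply/funext => l; rewrite exprS.
exact: multiplierM.
Qed.

(** Monomials are square integrable, so the products converge in the mean by
    domination. *)
Lemma multiplier_cvg (un : nat -> C -> R) (u : C -> R) (B : R) :
  (forall n, multiplier (un n)) -> (forall n l, `|un n l| <= B) ->
  (forall l, un n l @[n --> \oo] --> u l) -> multiplier u.
Proof.
move=> Mun unB unu.
have mu : measurable_fun setT (fun p : plane => u (cpt p)).
  apply: (@measurable_fun_cvg _ _ _ _ (fun n p => un n (cpt p))).
    by move=> n; have [] := Mun n.
  by move=> p _; exact: unu.
have uB l : `|u l| <= B.
  have cn : `|un n l| @[n --> \oo] --> `|u l| by apply: cvg_norm; exact: unu.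
  by rewrite -(cvg_lim _ cn)//; apply: limr_le;
    [apply/cvg_ex; exists `|u l| |apply: nearW => n; exact: unB].
have B0 : 0 <= B by apply: le_trans (uB 0).
split => //; first by exists B.
move=> a b; apply: (@hspan_dominated (fun n l => (un n l)%:C * emon a b l) _
    (fun l => B%:C * emon a b l)).
- by move=> n; have [] := Mun n.
- by apply: cmeasM; [exact: cmeas_real|have /inL2P[] := inL2_emon a b].
- exact/inL2Z/inL2_emon.
- by move=> n l; rewrite !normcM !normc_real ler_wpM2r ?mulr_ge0 ?normc_ge0 ?(ger0_norm B0).
- by move=> l; rewrite !normcM !normc_real ler_wpM2r ?mulr_ge0 ?normc_ge0 ?(ger0_norm B0).
- by move=> l; exact: cvg_real_mul_normc.
Qed.

Lemma multiplier_expR u : multiplier u -> multiplier (fun l => expR (u l)).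
Proof.
move=> Mu; have [_ [B uB] _] := Mu.
apply: (@multiplier_cvg (fun n l => series (exp_coeff (u l)) n) _ (expR B)).
- elim=> [|n IH].
    have -> : (fun l => series (exp_coeff (u l)) 0) = (fun=> 0).
      by apply/funext => l; rewrite /series /= big_geq.
    exact: multiplier_cst.
  have -> : (fun l => series (exp_coeff (u l)) n.+1) =
      (fun l => series (exp_coeff (u l)) n + n`!%:R^-1 * u l ^+ n).
    by apply/funext => l; rewrite seriesSr mulrC.
  exact: (multiplierD IH (multiplierZ _ (multiplierX n Mu))).
- move=> n l; apply: le_trans (exp_series_le _ _) _.
  by rewrite ler_expR.
- by move=> l; exact: exp_series_cvg.
Qed.

End completeness.

(** * Gaussians and half-planes as multipliers *)

Section gaussian_multipliers.
Variable R : realType.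
Local Notation C := R[i].
Local Notation plane := (measurableTypeR R * measurableTypeR R)%type.

Variable w : C.
Hypothesis w1 : normc w = 1.

(** A real coordinate in an arbitrary direction; [w = 1] and [w = - i] give the
    real and imaginary parts. *)
Definition lform (c : R) (l : C) : R := complex.Re (w * l) - c.

Lemma lformE c l : (lform c l)%:C =
  (w / 2) * l + (conjc w / 2) * conjc l - c%:C.
Proof.
by rewrite /lform rmorphB /= ReJ_add conjcM; field.
Qed.

Lemma measurable_lform c : measurable_fun setT (fun p : plane => lform c (cpt p)).
Proof.
have [m _] := cmeasZ w (cmeas_id R).
by apply: measurable_funB => //; exact: measurable_cst.
Qed.

Lemma hspan_lform_pow c m a b : hspan (fun l => (lform c l)%:C ^+ m * emon a b l).
Proof.
elim: m a b => [|m IH] a b.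
  by have := hspan_emon R a b; congr hspan; apply/funext => l; rewrite expr0 mul1r.
have := hspanB (hspanD (hspanZ (w / 2) (IH a.+1 b)) (hspanZ (conjc w / 2) (IH a b.+1)))
  (hspanZ c%:C (IH a b)).
congr hspan; apply/funext => l.
by rewrite [in RHS]exprS {4}lformE /emon !exprS; ring.
Qed.

Lemma lform_sq_le c l : lform c l ^+ 2 <= 2 * normc l ^+ 2 + 2 * c ^+ 2.
Proof.
have H := normc_Re_le (w * l); rewrite normcM w1 mul1r in H.
have H2 : complex.Re (w * l) ^+ 2 <= normc l ^+ 2.
  rewrite -(real_normK (num_real (complex.Re (w * l)))).
  by rewrite lerXn2r ?nnegrE ?normr_ge0 ?normc_ge0.
rewrite /lform; move: H2; move: (complex.Re _) (normc l) => x y H2.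
have := sqr_ge0 (x + c); nra.
Qed.

(** The Taylor polynomials of [exp (- s)] are bounded by [exp s].  With
    [s = lform ^ 2 / 16] this bound, times a monomial, is still square
    integrable, so the Taylor series converges in the mean and not only
    pointwise. *)
Lemma multiplier_gauss c : multiplier (fun l => expR (- (lform c l ^+ 2 / 16))).
Proof.
have mg (s : R) : measurable_fun setT (fun p : plane =>
    expR (s * (lform c (cpt p) ^+ 2 / 16))).
  apply: measurableT_comp => //; apply: measurable_funM => //.
  by apply: measurable_funM => //; apply: measurable_funX; exact: measurable_lform.
have mgN : measurable_fun setT (fun p : plane =>
    expR (- (lform c (cpt p) ^+ 2 / 16))).
  by have := mg (-1); under eq_fun do rewrite mulN1r.
have mgP : measurable_fun setT (fun p : plane =>
    expR (lform c (cpt p) ^+ 2 / 16)).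
  by have := mg 1; under eq_fun do rewrite mul1r.
split => //.
  exists 1 => l; rewrite ger0_norm ?expR_ge0// -[leRHS]expR0 ler_expR oppr_le0.
  by rewrite divr_ge0 ?sqr_ge0.
move=> a b.
(* lform ^ 2 / 16 is at most |l| ^ 2 / 8 plus a constant, and the monomial takes
   another |l| ^ 2 / 8: together they reach the |l| ^ 2 / 4 allowed in L^2. *)
have c8 : 0 < 8^-1 :> R by rewrite invr_gt0.
have [K K0 HK] := mono_growth 0 0 a b c8.
pose g l : C := (expR (lform c l ^+ 2 / 16))%:C * emon a b l.
have me : cmeas (emon a b : C -> C) by have /inL2P[] := inL2_emon R a b.
have Lg : inL2 g.
  apply: (@inL2_growth _ _ (K * expR (c ^+ 2 / 8))).
    by apply: cmeasM => //; exact: cmeas_real.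
  move=> l; rewrite /g normcM normc_real ger0_norm ?expR_ge0// emonE.
  apply: (@le_trans _ _ (expR (normc l ^+ 2 / 8 + c ^+ 2 / 8) *
      (K * expR (8^-1 * normc l ^+ 2)))).
    apply: ler_pM; rewrite ?expR_ge0 ?normc_ge0 ?HK// ler_expR.
    by have := lform_sq_le c l; lra.
  rewrite mulrCA -expRD -[leRHS]mulrA -expRD ler_wpM2l// ler_expR; lra.
apply: (@hspan_dominated _ (fun n l => (series (exp_coeff (- (lform c l ^+ 2 / 16))) n)%:C
   * emon a b l) _ g) => //.
- elim=> [|n IH].
    have := hspanZ 0 (hspan_emon R a b); congr hspan; apply/funext => l.
    by rewrite /series /= big_geq.
  have := hspanD IH (hspanZ (n`!%:R^-1 * (- 16^-1) ^+ n)%:C (hspan_lform_pow c (2 * n) a b)).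
  congr hspan; apply/funext => l; rewrite [in RHS]seriesSr [in RHS]rmorphD [in RHS]mulrDl.
  congr (_ + _); rewrite mulrA -rmorphXn -rmorphM; congr (_%:C * _).
  by rewrite /exp_coeff /= exprM -mulrA -exprMn mulrC mulNr [16^-1 * _]mulrC.
- by apply: cmeasM => //; exact: cmeas_real.
- move=> n l; rewrite /g !normcM ler_wpM2r ?mulr_ge0 ?normc_ge0// !normc_real.
  apply: le_trans (exp_series_le _ _) _.
  by rewrite normrN !ger0_norm ?expR_ge0// divr_ge0 ?sqr_ge0.
- move=> l; rewrite /g !normcM ler_wpM2r ?mulr_ge0 ?normc_ge0// !normc_real.
  rewrite !ger0_norm ?expR_ge0// ler_expR.
  by apply: (@le_trans _ _ 0); rewrite ?oppr_le0 divr_ge0 ?sqr_ge0.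
- by move=> l; apply: cvg_real_mul_normc; exact: exp_series_cvg.
Qed.

(** The functions [exp (- (u / c) ^ n)] converge to 1 below the level, to [exp (-1)]
    on it and to 0 above it; powers of this limit converge to the indicator. *)
Lemma multiplier_level (u : C -> R) c : multiplier u -> (forall l, 0 <= u l) ->
  0 < c -> multiplier (fun l => (u l < c)%R%:R).
Proof.
move=> Mu u0 c0.
pose g (l : C) : R := if u l < c then 1 else if u l == c then expR (-1) else 0.
have Mg : multiplier g.
  apply: (@multiplier_cvg _ (fun n l => expR ((-1) * (c^-1 * u l) ^+ n)) _ 1).
  - move=> n; apply: multiplier_expR; apply: multiplierZ; apply: multiplierX.
    exact: multiplierZ.
  - move=> n l; rewrite ger0_norm ?expR_ge0// -[leRHS]expR0 ler_expR mulN1r oppr_le0.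
    by rewrite exprn_ge0// mulr_ge0// invr_ge0 ltW.
  move=> l; set q := c^-1 * u l.
  have q0 : 0 <= q by rewrite mulr_ge0// invr_ge0 ltW.
  have qlt : (u l < c) = (q < 1) by rewrite /q mulrC ltr_pdivrMr// mul1r.
  have qeq : (u l == c) = (q == 1).
    by rewrite /q mulrC; apply/eqP/eqP => [->|H]; [rewrite divff// gt_eqF|
      rewrite -[LHS](divfK (lt0r_neq0 c0)) H mul1r].
  rewrite /g qlt qeq; case: ltgtP => q1.
  - have qn : q ^+ n @[n --> \oo] --> 0 by apply: cvg_expr; rewrite ger0_norm.
    have H : expR (-1 * q ^+ n) @[n --> \oo] --> expR (-1 * 0).
      apply: (@continuous_cvg _ _ _ _ _ (fun n => -1 * q ^+ n) expR).
        exact: continuous_expR.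
      by apply: cvgM => //; exact: cvg_cst.
    by rewrite mulr0 expR0 in H.
  - have qi : `|q^-1| < 1 by rewrite ger0_norm ?invr_ge0// invf_lt1// (lt_trans _ q1).
    apply: squeeze_cvgr (cvg_cst 0) (cvg_expr qi); apply/nearW => n /=.
    rewrite expR_ge0/= mulN1r expRN exprVn lef_pV2 ?posrE ?expR_gt0 ?exprn_gt0//.
      by apply: le_trans (expR_ge1Dx _); rewrite lerDr.
    exact: lt_trans q1.
  - by rewrite q1; under eq_fun do rewrite expr1n mulr1; exact: cvg_cst.
have g01 l : 0 <= g l <= 1.
  rewrite /g; case: ifP => _; first by rewrite lexx ler01.
  by case: ifP => _; rewrite ?lexx ?ler01// expR_ge0 -[leRHS]expR0 ler_expR lerN10.
apply: (@multiplier_cvg _ (fun n l => g l ^+ n) _ 1).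
- by move=> n; exact: multiplierX.
- move=> n l; have /andP[g0 g1] := g01 l.
  by rewrite ger0_norm ?exprn_ge0// exprn_ile1.
move=> l; rewrite /g; case: ifP => _.
  by under eq_fun do rewrite expr1n; exact: cvg_cst.
apply: cvg_expr; case: ifP => _; last by rewrite normr0.
by rewrite ger0_norm ?expR_ge0// -[ltRHS]expR0 ltr_expR ltrN10.
Qed.

(** The half-plane is the limit of the regions where [lform (c + n)] exceeds [n]
    in absolute value: below [c] this always holds, and from [c] on it fails
    as soon as [n] is larger than the distance to [c]. *)
Lemma multiplier_ray c : multiplier (fun l => (complex.Re (w * l) < c)%R%:R).
Proof.
apply: (@multiplier_cvg _ (fun n l => (expR (- (lform (c + n%:R) l ^+ 2 / 16)) <
   expR (- (n%:R ^+ 2 / 16)))%R%:R) _ 1).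
- move=> n; apply: multiplier_level; [exact: multiplier_gauss| |exact: expR_gt0].
  by move=> l; exact: expR_ge0.
- by move=> n l; case: (_ < _); rewrite ?normr1 ?normr0.
move=> l; apply: cvg_near_cst; near=> n; congr (nat_of_bool _)%:R.
rewrite ltr_expR ltrN2 ltr_pM2r ?invr_gt0// /lform.
have nn : complex.Re (w * l) - c < n%:R by near: n; exact: nbhs_infty_gtr.
move: nn; move: (complex.Re _) => x nn.
have n0 : 0 <= n%:R :> R by [].
case: (ltP x c) => xc; last by apply/negbTE; rewrite -leNgt; nra.
by nra.
Unshelve. all: by end_near. Qed.

End gaussian_multipliers.

(** * Completeness of the complex Hermite polynomials *)

Section density_of_span.
Variable R : realType.
Local Notation C := R[i].
Local Notation plane := (measurableTypeR R * measurableTypeR R)%type.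

Definition point_of (l : C) : plane := (complex.Re l, complex.Im l).

Lemma cptK p : point_of (cpt p) = p. Proof. by case: p. Qed.

Lemma point_ofK l : cpt (point_of l) = l. Proof. by case: l. Qed.

Definition mult_set (A : set plane) := multiplier (fun l => \1_A (point_of l) : R).

Lemma indic_le1 (A : set plane) l : `|\1_A (point_of l) : R| <= 1.
Proof. by rewrite indicE; case: (_ \in _); rewrite ?normr1 ?normr0. Qed.

Lemma mult_set0 : mult_set set0.
Proof.
have := multiplier_cst (0 : R); congr multiplier; apply/funext => l.
by rewrite indicE in_set0.
Qed.

Lemma mult_setC A : mult_set A -> mult_set (~` A).
Proof.
move=> MA; have := multiplierD (multiplier_cst (1 : R)) (multiplierZ (-1) MA).
congr multiplier; apply/funext => l; rewrite !indicE in_setC.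
by case: (_ \in _); rewrite /= ?mulr1 ?mulr0 ?subrr ?addr0.
Qed.

Lemma mult_setU A B : mult_set A -> mult_set B -> mult_set (A `|` B).
Proof.
move=> MA MB; have := multiplierD (multiplierD MA MB)
  (multiplierZ (-1) (multiplierM MA MB)).
congr multiplier; apply/funext => l; rewrite !indicE in_setU.
by case: (_ \in A); case: (_ \in B) => /=; ring.
Qed.

Lemma mult_set_bigcup (A : nat -> set plane) : (forall n, mult_set (A n)) ->
  mult_set (\bigcup_n A n).
Proof.
move=> MA; pose U n := \big[setU/set0]_(i < n) A i.
have MU n : mult_set (U n).
  rewrite /U; elim: n => [|n IH]; first by rewrite big_ord0; exact: mult_set0.
  by rewrite big_ord_recr /=; exact: (mult_setU IH (MA n)).
apply: (@multiplier_cvg R (fun n l => \1_(U n) (point_of l)) _ 1) => //.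
  by move=> n l; exact: indic_le1.
move=> l; apply: cvg_near_cst.
have [[k _ Ak]|nA] := pselect ((\bigcup_n A n) (point_of l)).
  near=> n; rewrite !indicE; congr (nat_of_bool _)%:R.
  rewrite !mem_set//; first by exists k.
  rewrite /U -bigcup_mkord; exists k => //=.
  by near: n; exact: nbhs_infty_gt.
near=> n; rewrite !indicE !memNset//.
by rewrite /U -bigcup_mkord => -[j _ Aj]; apply: nA; exists j.
Unshelve. all: by end_near. Qed.

(** Multipliers form an algebra closed under bounded pointwise limits. *)
Lemma sigma_algebra_mult_set : sigma_algebra setT mult_set.
Proof.
split; [exact: mult_set0| |exact: mult_set_bigcup].
by move=> A MA; rewrite setTD; exact: mult_setC.
Qed.

Lemma mult_set_preimage (pr : plane -> R) (w : C) (B : set (measurableTypeR R)) :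
  normc w = 1 -> (forall l, complex.Re (w * l) = pr (point_of l)) ->
  measurable B -> mult_set (pr @^-1` B).
Proof.
move=> w1 prE mB.
have sB : sigma_algebra setT (fun B : set (measurableTypeR R) => mult_set (pr @^-1` B)).
  split; first by rewrite preimage_set0; exact: mult_set0.
    by move=> A MA; rewrite setTD preimage_setC; exact: mult_setC.
  by move=> A MA; rewrite preimage_bigcup; exact: mult_set_bigcup.
have {}mB : (@RGenInftyO.G R).-sigma.-measurable B.
  by rewrite -RGenInftyO.measurableE; exact: mB.
apply: (smallest_sub sB _ mB) => _ [c ->] /=.
have := @multiplier_ray R w w1 c; congr multiplier; apply/funext => l.
rewrite indicE prE; congr (nat_of_bool _)%:R; apply/esym.
by apply/idP/idP; rewrite inE /= in_itv.
Qed.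

Lemma measurable_mult_set (A : set plane) : measurable A -> mult_set A.
Proof.
apply: smallest_sub; first exact: sigma_algebra_mult_set.
move=> _ [[B mB <-]|[B mB <-]]; rewrite setTI.
  apply: (@mult_set_preimage fst 1) => // [|l]; first exact: normc1.
  by rewrite mul1r.
apply: (@mult_set_preimage snd (- 'i%C)) => // [|l].
  by rewrite /normc /= oppr0 expr0n /= sqrrN expr1n add0r sqrtr1.
by rewrite ReM /=; ring.
Qed.

Import HBNNSimple.

(** Increasing simple functions are dominated by their limit. *)
Lemma hspan_ge0 (u : plane -> R) : measurable_fun setT u -> (forall p, 0 <= u p) ->
  inL2 (fun l => (u (point_of l))%:C) -> hspan (fun l => (u (point_of l))%:C).
Proof.
move=> mu u0 Lu.
have mU : measurable_fun setT (EFin \o u) by exact/measurable_EFinP.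
have U0 p : setT p -> (0 <= (EFin \o u) p)%E by move=> _; rewrite lee_fin.
pose h := nnsfun_approx measurableT mU.
have hu p : h n p @[n --> \oo] --> u p.
  by have /fine_cvgP[_] := cvg_nnsfun_approx measurableT mU U0 (I : setT p).
have hle n p : h n p <= u p.
  rewrite -(cvg_lim _ (hu p))//; apply: nondecreasing_cvgn_le.
    by move=> a b ab; exact/lefP/nd_nnsfun_approx.
  by apply/cvg_ex; exists (u p); exact: hu.
have Vh n : hspan (fun l => (h n (point_of l))%:C).
  have : hspan (fun l => \sum_(y <- fset_set (range (h n)))
      y%:C * ((\1_(h n @^-1` [set y]) (point_of l) : R)%:C * emon 0 0 l)).
    apply: hspan_sum => y; apply: hspanZ.
    (* Multipliers are tested against the constant monomial. *)
    have [_ _] : mult_set (h n @^-1` [set y]) by apply: measurable_mult_set.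
    exact.
  congr hspan; apply/funext => l; rewrite [in RHS]fimfunE fsbig_finite//= rmorph_sum.
  by apply: eq_bigr => y _; rewrite /emon !expr0 !mulr1 -rmorphM.
apply: (hspan_dominated Vh _ Lu).
- by case/inL2P: Lu.
- move=> n l; rewrite !normc_real !ger0_norm//.
- by [].
- move=> l; have := cvg_real_mul_normc 1 (hu (point_of l)).
  by under eq_fun do rewrite !mulr1.
Qed.

Lemma hspan_real (u : C -> R) : measurable_fun setT (fun p : plane => u (cpt p)) ->
  inL2 (fun l => (u l)%:C) -> hspan (fun l => (u l)%:C).
Proof.
move=> mu Lu.
have LU (v : plane -> R) : measurable_fun setT v ->
    (forall p, 0 <= v p <= `|u (cpt p)|) -> hspan (fun l => (v (point_of l))%:C).
  move=> mv vu; apply: hspan_ge0 => //; first by move=> p; case/andP: (vu p).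
  apply: inL2_le Lu _.
    by apply: cmeas_real; under eq_fun do rewrite cptK.
  move=> l; rewrite !normc_real.
  have /andP[v0 vle] := vu (point_of l); rewrite ger0_norm//.
  by move: vle; rewrite point_ofK.
have V1 : hspan (fun l => (Num.max (u (cpt (point_of l))) 0)%:C).
  apply: (LU (fun p => Num.max (u (cpt p)) 0)).
    by apply: measurable_maxr => //; exact: measurable_cst.
  by move=> p; rewrite le_max lexx orbT ge_max ler_norm normr_ge0.
have V2 : hspan (fun l => (Num.max (- u (cpt (point_of l))) 0)%:C).
  apply: (LU (fun p => Num.max (- u (cpt p)) 0)).
    by apply: measurable_maxr; [exact: measurableT_comp|exact: measurable_cst].
  by move=> p; rewrite le_max lexx orbT ge_max -normrN ler_norm normr_ge0.
have := hspanB V1 V2; congr hspan; apply/funext => l.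
rewrite !point_ofK -rmorphB; congr (_%:C).
case: (leP 0 (u l)) => u0; first by rewrite max_r ?oppr_le0// subr0.
by rewrite max_l ?oppr_ge0 ?(ltW u0)// sub0r opprK.
Qed.

Lemma hspan_full (f : C -> C) : inL2 f -> hspan f.
Proof.
move=> Lf; have [mr mi _] := Lf.
have VRe : hspan (fun l => (complex.Re (f l))%:C).
  apply: hspan_real => //; apply: inL2_le Lf _; first exact: cmeas_real.
  by move=> l; rewrite normc_real normc_Re_le.
have VIm : hspan (fun l => (complex.Im (f l))%:C).
  apply: hspan_real => //; apply: inL2_le Lf _; first exact: cmeas_real.
  by move=> l; rewrite normc_real normc_Im_le.
have := hspanD VRe (hspanZ 'i%C VIm); congr hspan; apply/funext => l.
by rewrite -complexE.
Qed.

End density_of_span.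

(** * From complex to bicomplex functions *)

Local Existing Instance totally_filter.

Section bicomplex_layer.
Variable R : realType.
Local Notation C := R[i].
Local Notation BC := (bicomplex R).

Lemma lam1D (Z W : BC) : lam1 (Z + W) = lam1 Z + lam1 W.
Proof. by rewrite /lam1 /= mulrDr; ring. Qed.
Lemma lam2D (Z W : BC) : lam2 (Z + W) = lam2 Z + lam2 W.
Proof. by rewrite /lam2 /= mulrDr; ring. Qed.
Lemma lam1N (Z : BC) : lam1 (- Z) = - lam1 Z.
Proof. by rewrite /lam1 /= ; ring. Qed.
Lemma lam2N (Z : BC) : lam2 (- Z) = - lam2 Z.
Proof. by rewrite /lam2 /= ; ring. Qed.
Lemma lam1M (Z W : BC) : lam1 (Z * W) = lam1 Z * lam1 W.
Proof. by have ii := sqri R; rewrite /lam1 /=; ring: ii. Qed.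
Lemma lam2M (Z W : BC) : lam2 (Z * W) = lam2 Z * lam2 W.
Proof. by have ii := sqri R; rewrite /lam2 /=; ring: ii. Qed.
Lemma lam1_1 : lam1 (1 : BC) = 1.
Proof. by rewrite /lam1 /= mulr0 subr0. Qed.
Lemma lam2_1 : lam2 (1 : BC) = 1.
Proof. by rewrite /lam2 /= mulr0 addr0. Qed.
Lemma lam1_0 : lam1 (0 : BC) = 0.
Proof. by rewrite /lam1 /= mulr0 subr0. Qed.
Lemma lam2_0 : lam2 (0 : BC) = 0.
Proof. by rewrite /lam2 /= mulr0 addr0. Qed.

Section components.
Variable lam : BC -> C.
Hypothesis lamD : forall Z W, lam (Z + W) = lam Z + lam W.
Hypothesis lamN : forall Z, lam (- Z) = - lam Z.
Hypothesis lamM : forall Z W, lam (Z * W) = lam Z * lam W.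
Hypothesis lam_1 : lam 1 = 1.
Hypothesis lam_0 : lam 0 = 0.
Hypothesis lam_star : forall Z, lam (bcstar Z) = conjc (lam Z).

Lemma lam_sum (I : Type) (s : seq I) (F : I -> BC) :
  lam (\sum_(k <- s) F k) = \sum_(k <- s) lam (F k).
Proof. exact: (big_morph lam lamD lam_0). Qed.

Lemma lamX Z n : lam (Z ^+ n) = lam Z ^+ n.
Proof. by elim: n => [|n IH]; rewrite ?expr0// !exprS lamM IH. Qed.

Lemma lam_nat n : lam n%:R = n%:R.
Proof. by elim: n => [|n IH]; rewrite ?lam_0// -!natr1 lamD IH lam_1. Qed.

Lemma lam_hermite m n Z : lam (bchermite m n Z) = hermite m n (lam Z).
Proof.
rewrite hermiteE /bchermite /bchermite2 lam_sum; apply: eq_bigr => k _.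
by rewrite !lamM !lamX lamN lam_1 lam_nat lam_star.
Qed.

End components.

Lemma star_lam1 (Z : BC) : lam1 (bcstar Z) = conjc (lam1 Z).
Proof. by rewrite -{1}(bcsplitK Z) bcstar_split lam1_split. Qed.
Lemma star_lam2 (Z : BC) : lam2 (bcstar Z) = conjc (lam2 Z).
Proof. by rewrite -{1}(bcsplitK Z) bcstar_split lam2_split. Qed.

Lemma lam1_hermite m n (Z : BC) : lam1 (bchermite m n Z) = hermite m n (lam1 Z).
Proof.
exact: (lam_hermite lam1D lam1N lam1M lam1_1 lam1_0 star_lam1).
Qed.
Lemma lam2_hermite m n (Z : BC) : lam2 (bchermite m n Z) = hermite m n (lam2 Z).
Proof.
exact: (lam_hermite lam2D lam2N lam2M lam2_1 lam2_0 star_lam2).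
Qed.

Lemma bchermite_split m n l1 l2 :
  bchermite m n (bcsplit l1 l2) = bcsplit (hermite m n l1) (hermite m n l2) :> BC.
Proof.
by rewrite -[LHS]bcsplitK lam1_hermite lam2_hermite lam1_split lam2_split.
Qed.

Lemma comp_hermite m n : comp1 (bchermite m n : BC -> BC) = hermite m n /\
  comp2 (bchermite m n : BC -> BC) = hermite m n.
Proof. by apply: comp_split => l1 l2; exact: bchermite_split. Qed.

Lemma inner_hermite m n a b :
  inner_split (bchermite m n : BC -> BC) (bchermite a b) =
  if (m == a) && (n == b) then (m`! * n`!)%:R else 0.
Proof.
have [c1 c2] := comp_hermite m n; have [d1 d2] := comp_hermite a b.
rewrite /inner_split c1 c2 d1 d2 cinner_hermite.
rewrite -[RHS]bcsplitK; case: ifP => _.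
  by rewrite (lam_nat lam1D lam1_1 lam1_0) (lam_nat lam2D lam2_1 lam2_0).
by rewrite lam1_0 lam2_0.
Qed.

Local Notation hk := (fun k : nat * nat => bchermite k.1 k.2 : BC -> BC).

(** Stating convergence for the squared norms makes it the condition that defines
    the closed span. *)
Lemma cnormL2_cvg0 (I : choiceType) (G : {fset I} -> C -> C) :
  (forall A, inL2 (G A)) ->
  (cnormL2 (G A) @[A --> totally] --> 0%E) <->
  (forall e : R, 0 < e -> exists A0 : {fset I}, forall A : {fset I},
     (A0 `<=` A)%fset -> sqnormL2 (G A) < e).
Proof.
move=> LG.
have E A : cnormL2 (G A) = (Num.sqrt (sqnormL2 (G A)))%:E by exact: cnormL2_sqnormL2.
split=> [/fine_cvgP[_ /cvgrPdist_lt H] e e0|H].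
  have se0 : 0 < Num.sqrt e by rewrite sqrtr_gt0.
  have [A0 _ HA] := H _ se0; exists A0 => A A0A.
  have := HA A A0A; rewrite /= E /= sub0r normrN ger0_norm ?sqrtr_ge0//.
  by rewrite ltr_sqrt.
apply/fine_cvgP; split.
  by exists fset0 => // A _; rewrite /= E.
apply/cvgrPdist_lt => e e0.
have [A0 HA] := H _ (exprn_gt0 2 e0); exists A0 => // A A0A.
rewrite /= E /= sub0r normrN ger0_norm ?sqrtr_ge0//.
by rewrite -(ger0_norm (ltW e0)) -sqrtr_sqr ltr_sqrt ?HA// exprn_gt0.
Qed.

Section expansion.
Variables (f : BC -> BC) (f1 f2 : C -> C).
Hypothesis Lf1 : inL2 f1.
Hypothesis Lf2 : inL2 f2.
Hypothesis fE : forall l1 l2, f (bcsplit l1 l2) = bcsplit (f1 l1) (f2 l2).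

Lemma comp_rest (A : {fset nat * nat}) (gamma : nat * nat -> BC) :
  comp1 (fun Z => f Z - \sum_(k <- A) hk k Z * gamma k) =
    (fun l => f1 l - lincomb (@hfam R) A (fun k => lam1 (gamma k)) l) /\
  comp2 (fun Z => f Z - \sum_(k <- A) hk k Z * gamma k) =
    (fun l => f2 l - lincomb (@hfam R) A (fun k => lam2 (gamma k)) l).
Proof.
apply: comp_split => l1 l2; rewrite fE -[LHS]bcsplitK; congr bcsplit.
  rewrite lam1D lam1N lam1_split (lam_sum lam1D lam1_0); congr (_ - _).
  by apply: eq_bigr => k _; rewrite lam1M lam1_hermite lam1_split.
rewrite lam2D lam2N lam2_split (lam_sum lam2D lam2_0); congr (_ - _).
by apply: eq_bigr => k _; rewrite lam2M lam2_hermite lam2_split.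
Qed.

Definition cvg_series_to (g : C -> C) (d : nat * nat -> C) :=
  forall e : R, 0 < e -> exists A0 : {fset nat * nat}, forall A : {fset nat * nat},
    (A0 `<=` A)%fset -> sqnormL2 (fun l => g l - lincomb (@hfam R) A d l) < e.

Lemma expandsP gamma : expands hk f gamma <->
  cvg_series_to f1 (fun k => lam1 (gamma k)) /\
  cvg_series_to f2 (fun k => lam2 (gamma k)).
Proof.
have E1 (A : {fset nat * nat}) := (comp_rest A gamma).1.
have E2 (A : {fset nat * nat}) := (comp_rest A gamma).2.
rewrite /expands /=.
under eq_fun do rewrite E1; under [X in _ /\ X @ _ --> _]eq_fun do rewrite E2.
have L g (A : {fset nat * nat}) d : inL2 g -> inL2 (fun l => g l - lincomb (@hfam R) A d l).
  by move=> Lg; apply: inL2B => //; exact: (inL2_lincomb (@inL2_hfam R)).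
by split=> -[H1 H2]; split; [apply/(cnormL2_cvg0 (fun A => L _ A _ Lf1))|
  apply/(cnormL2_cvg0 (fun A => L _ A _ Lf2))|
  apply/(cnormL2_cvg0 (fun A => L _ A _ Lf1))|
  apply/(cnormL2_cvg0 (fun A => L _ A _ Lf2))].
Qed.

End expansion.

Local Notation coef := (fcoef (@hfam R) (@hsqnorm R)).

Lemma cvg_series_coef g : inL2 g -> cvg_series_to g (coef g).
Proof. by move=> Lg; have [_] := hspan_full Lg. Qed.

(** The error on a coefficient is at most the distance to any partial sum that
    contains its index. *)
Lemma cvg_series_unique g d : inL2 g -> cvg_series_to g d -> d = coef g.
Proof.
move=> Lg H; apply/funext => k; apply/eqP; rewrite -subr_eq0; apply/eqP.
apply: eq0_normc; apply/eqP; rewrite -sqrf_eq0 eq_le sqr_ge0 andbT leNgt.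
apply/negP => dk.
have Nk := @hsqnorm_gt0 R k.
have [A0 /(_ (k |` A0)%fset (fsubsetU1 _ _))] := H _ (mulr_gt0 Nk dk).
apply/negP; rewrite -leNgt.
apply: (coef_close (@inL2_hfam R) (@hfam_orth R) (@hfam_norm R) (@hsqnorm_gt0 R)) => //.
exact: fset1U1.
Qed.

End bicomplex_layer.

Theorem theorem5p13 (R : realType) :
  orthogonal_basis
    (fun (k : nat * nat) (Z : bicomplex R) => bchermite k.1 k.2 Z) /\
  (forall m n : nat,
    normsq_split (fun Z : bicomplex R => bchermite m n Z) = (m`! * n`!)%:R).
Proof.
split; last by move=> m n; rewrite /normsq_split inner_hermite !eqxx.
split.
- move=> [m n]; exists (hermite m n), (hermite m n).
  by split; [exact: inL2_hermite..|exact: bchermite_split].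
- by move=> [m n] [a b]; rewrite xpair_eqE inner_hermite => /negPf ->.
move=> f [f1 [f2 [Lf1 Lf2 fE]]].
exists (fun k => bcsplit (fcoef (@hfam R) (@hsqnorm R) f1 k) (fcoef (@hfam R) (@hsqnorm R) f2 k)).
split.
  apply/(expandsP Lf1 Lf2 fE); split.
    by under eq_fun do rewrite lam1_split; exact: cvg_series_coef.
  by under eq_fun do rewrite lam2_split; exact: cvg_series_coef.
move=> gamma /(expandsP Lf1 Lf2 fE)[H1 H2]; apply/funext => k.
rewrite -[RHS]bcsplitK -(cvg_series_unique Lf1 H1) -(cvg_series_unique Lf2 H2).
by [].
Qed.
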